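(* If all the extensions $K_n\subset K_{n+1}$, $n\ge1$, in the sequence $k=K_1\subset K_2\subset\cdots$ are tamely ramified, then for every integer $N\ge1$ $$ \liminf_{n\to\infty}Q(n,N)>0, $$ where, for $n>N$, $$ Q(n,N)=\mathbf P\left\{X_S(t)\notin S_n\ \ \forall\, t\in[\pi(n),\pi(N))\right\} $$ and $\pi(n)$ is the first exit time of the process $X_S(t)$ out of the subgroup $S_n$.
   Context: Fields. Let $k$ be a non-Archimedean local field of characteristic zero and let $k=K_1\subset K_2\subset\cdots\subset K_n\subset\cdots$ be a strictly increasing sequence of finite extensions, $K=\bigcup_{n\ge1}K_n$. A finite extension of local fields is called tamely ramified if its ramification index is not divisible by the residue characteristic (unramified extensions are included). For each $n$: $|\cdot|_n$ is the normalized absolute value of $K_n$; $q_n$ is the residue field cardinality of $K_n$; $m_n=[K_n:k]$; $f_n$ is the inertia index of $K_n/k$; $d_n$ is the exponent of the different of $K_n/k$, i.e. the largest integer $d$ such that $|\mathrm{Tr}_{K_n/k}(x)|_1\le1$ for all $x\in K_n$ with $|x|_n\le q_n^{d}$. $\|\cdot\|$ is the absolute value on $K$ extending $|\cdot|_1$, i.e. $\|x\|=|x|_n^{1/m_n}$ for $x\in K_n$. The maps $T_n$ and the space $\overline{K}$. $T_n:K\to K_n$ is defined by $T_n(x)=\frac{m_n}{m_\nu}\mathrm{Tr}_{K_\nu/K_n}(x)$ for $x\in K_\nu$, $\nu>n$, and $T_n(x)=x$ for $x\in K_n$; it is well defined; $T=T_1$. $\overline{K}$ is the projective limit of $\{K_n\}$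 with respect to $\{T_n\}$: the set of $x=(x_1,x_2,\ldots)\in\prod_n K_n$ with $x_n=T_n(x_\nu)$ for $\nu>n$, with the topology given by the seminorms $\|x\|_n=\|x_n\|$. For $x\in\overline{K}$ put $T_n(x)=x_n$. The pairing between $K$ and $\overline{K}$ is $\langle x,y\rangle=T(xy_n)$ for $x\in K_n\subset K$, $y=(y_1,y_2,\ldots)\in\overline{K}$ (independent of the choice of $n$ with $x\in K_n$). Subgroups. $S=\{x\in\overline{K}:\ \|T_n(x)\|\le q_n^{d_n/m_n}\|m_n\|,\ n=1,2,\ldots\}$, a compact subgroup of $\overline{K}$ (here $\|m_n\|$ is the absolute value of the integer $m_n$ viewed in $k$). $S_0=S$ and $S_n=\{x\in S:\ \|T_n(x)\|\le q_n^{d_n/m_n-n/f_n}\|m_n\|\}$ for $n\ge1$; these form a descending chain of open compact subgroups of $S$ which is a base of neighbourhoods of $0$ in $S$. Process. Let $\chi$ be a rank zero additive character of $k$ (a continuous unitary character trivial on $\{|x|_1\le1\}$ but not on $\{|x|_1\le q_1\}$). For a fixed $\alpha>0$ there is a convolution semigroup $\pi(t,dx)$, $t>0$, of Radon probability measures on $\overline{K}$, concentrated on $S$, with $\int_{\overline{K}}\chi(\langle\xi,x\rangle)\,\pi(t,dx)=e^{-t\|\xi\|^\alpha}$ if $\xi\in K$, $\|\xi\|>1$, and $=1$ if $\xi\in K$, $\|\xi\|\le1$. $X_S(t)$ is the Lévy process on the compact group $S$ (stationary independent increments, $X_S(0)=0$, right-continuous paths with left limits) with $X_S(t)$ distributed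 according to $\pi(t,\cdot)$. The first exit time is $\pi(n)=\inf\{t\ge0:\ X_S(t)\notin S_n\}$. *)

(* Defs.v *)
From HB Require Import structures.
From mathcomp Require Import all_boot all_order all_algebra.
From mathcomp Require Import all_classical all_reals all_analysis.
From mathcomp Require Import finmap complex.
Set Implicit Arguments.
Unset Strict Implicit.
Unset Printing Implicit Defensive.
Import Order.TTheory GRing.Theory Num.Theory.
Import numFieldNormedType.Exports.
Local Open Scope classical_set_scope.
Local Open Scope ring_scope.

(* The union K of a tower has infinite degree over k, so fieldExtType is not
   available for it: the layers are subfields of K, given by divringClosed
   predicates.  Degrees and indices are picked by xget, with a default value
   that is only used when no such number exists. *)

Section FiniteExtensions.
Variable K : fieldType.
Implicit Types F E : {pred K}.

Definition basis_over F E (m : nat) (e : 'I_m -> K) : Prop :=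
  [/\ forall i, e i \in E,
      forall x, x \in E ->
        exists2 c : 'I_m -> K, forall i, c i \in F & x = \sum_i c i * e i
    & forall c : 'I_m -> K, (forall i, c i \in F) ->
        \sum_i c i * e i = 0 -> forall i, c i = 0].

Definition finite_extension F E : Prop :=
  exists (m : nat) (e : 'I_m -> K), basis_over F E e.

Definition ext_degree F E : nat :=
  xget 0%N [set m | exists e : 'I_m -> K, basis_over F E e].

Definition ext_basis F E : 'I_(ext_degree F E) -> K :=
  xget (fun=> 0) [set e | basis_over F E e].

(* A is the matrix over F of y |-> x * y on E, in the chosen basis. *)
Definition is_mulmx F E (x : K) (A : 'M[K]_(ext_degree F E)) : Prop :=
  A \is a mxOver F /\
  forall i, x * @ext_basis F E i = \sum_j A i j * @ext_basis F E j.

Definition mul_matrix F E (x : K) : 'M[K]_(ext_degree F E) :=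
  xget 0 [set A | is_mulmx x A].

Definition ext_trace F E (x : K) : K := \tr (mul_matrix F E x).

End FiniteExtensions.

Section AbsoluteValues.
Variables (R : realType) (K : fieldType).
Implicit Types (F E : {pred K}) (a : K -> R).

Definition abs_integers F a : set K := [set x | x \in F /\ a x <= 1].

Definition residue_class F a (x : K) : set K :=
  [set y | y \in F /\ a (y - x) < 1].

Definition residue_field F a : set (set K) :=
  residue_class F a @` abs_integers F a.

Definition residue_card F a : nat := #|` fset_set (residue_field F a)|.

Record nonarch_abs F a : Prop := NonarchAbs {
  nonarch_ge0 : forall x, x \in F -> 0 <= a x;
  nonarch_eq0 : forall x, x \in F -> (a x = 0 <-> x = 0);
  nonarch_mul : forall x y, x \in F -> y \in F -> a (x * y) = a x * a y;
  nonarch_add : forall x y, x \in F -> y \in F ->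
    a (x + y) <= Num.max (a x) (a y) }.

Definition abs_complete F a : Prop :=
  forall u : nat -> K, (forall n, u n \in F) ->
    (forall eps : R, 0 < eps -> exists N, forall m n,
        (N <= m)%N -> (N <= n)%N -> a (u m - u n) < eps) ->
    exists2 l : K, l \in F & (fun n => a (u n - l)) @ \oo --> (0 : R).

(* F is a non-Archimedean local field and a is its normalized absolute
   value: complete, finite residue field with q elements, value group q^Z. *)
Record local_field_normalized F a : Prop := LocalFieldNormalized {
  lfn_abs : nonarch_abs F a;
  lfn_complete : abs_complete F a;
  lfn_residue : finite_set (residue_field F a);
  lfn_values : [set a x | x in [set x | x \in F /\ x != 0]]
               = [set (residue_card F a)%:R ^ z | z in [set: int]] }.

(* Degree of the residue field extension, expressed on representatives. *)
Definition residue_basis F E a (f : nat) (w : 'I_f -> K) : Prop :=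
  [/\ forall i, abs_integers E a (w i),
      forall x, abs_integers E a x ->
        exists2 c : 'I_f -> K, forall i, abs_integers F a (c i)
          & a (x - \sum_i c i * w i) < 1
    & forall c : 'I_f -> K, (forall i, abs_integers F a (c i)) ->
        a (\sum_i c i * w i) < 1 -> forall i, a (c i) < 1].

Definition inertia_index F E a : nat :=
  xget 0%N [set f | exists w : 'I_f -> K, residue_basis F E a w].

Definition uniformizer F a (p : K) : Prop :=
  [/\ p \in F, p != 0, a p < 1
    & forall x, x \in F -> a x < 1 -> a x <= a p].

Definition ramification_index F E a : nat :=
  xget 0%N [set e | exists pF pE : K,
    [/\ uniformizer F a pF, uniformizer E a pE & a pF = a pE ^+ e]].

Definition residue_characteristic a (p : nat) : Prop :=
  prime p /\ a (p%:R) < 1.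

Definition tamely_ramified F E a : Prop :=
  forall p : nat, residue_characteristic a p ->
    ~~ (p %| ramification_index F E a)%N.

End AbsoluteValues.

(* Layers are numbered from 0: layer T 0 is k = K_1 and layer T n is the field
   K_{n+1} of a tower K_1, K_2, etc.  labs T n is the normalized absolute value
   of layer T n (irrelevant outside that layer), tnorm T is the absolute value
   of K that extends labs T 0. *)
Record local_tower (R : realType) (K : fieldType) := LocalTower {
  layer : nat -> divringClosed K;
  labs : nat -> K -> R;
  tnorm : K -> R;
  tower_char0 : [pchar K] =i pred0;
  tower_mono : forall n x, x \in layer n -> x \in layer n.+1;
  tower_strict : forall n, exists2 x, x \in layer n.+1 & x \notin layer n;
  tower_union : forall x : K, exists n, x \in layer n;
  tower_finite : forall n, finite_extension (layer 0) (layer n);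
  tower_local : forall n, local_field_normalized (layer n) (labs n);
  tower_norm : forall n x, x \in layer n ->
    tnorm x = labs n x `^ (ext_degree (layer 0) (layer n))%:R^-1 }.

Section Invariants.
Variables (R : realType) (K : fieldType) (T : local_tower R K).

Definition lq (n : nat) : nat := residue_card (layer T n) (labs T n).

Definition ldeg (n : nat) : nat := ext_degree (layer T 0) (layer T n).

Definition linert (n : nat) : nat :=
  inertia_index (layer T 0) (layer T n) (tnorm T).

Definition diff_bound (n : nat) (d : int) : Prop :=
  forall x, x \in layer T n -> labs T n x <= (lq n)%:R ^ d ->
    labs T 0 (ext_trace (layer T 0) (layer T n) x) <= 1.

Definition ldiff (n : nat) : int :=
  xget 0 [set d | diff_bound n d /\ forall d', diff_bound n d' -> d' <= d].

(* The map T_n : K -> K_n, restricted to x \in layer T nu; by transitivity of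
   the trace the value does not depend on the layer containing x. *)
Definition tower_map (n nu : nat) (x : K) : K :=
  if (nu <= n)%N then x
  else (ldeg n)%:R / (ldeg nu)%:R * ext_trace (layer T n) (layer T nu) x.

Definition Kbar_pred : {pred nat -> K} := fun x =>
  `[< (forall n, x n \in layer T n) /\
      (forall n nu, (n < nu)%N -> x n = tower_map n nu (x nu)) >].

End Invariants.

Section TraceAdditive.
Variables (K : fieldType) (F E : divringClosed K).

Lemma ext_basisP : finite_extension F E -> basis_over F E (@ext_basis K F E).
Proof.
move=> fin; rewrite /ext_basis; case: xgetP => [e _ //|] none.
have : [set m | exists e : 'I_m -> K, basis_over F E e] (ext_degree F E).
  by apply: xgetPex.
by case=> e /none.
Qed.

Lemma ext_degree_infinite : ~ finite_extension F E -> ext_degree F E = 0%N.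
Proof.
by move=> nfin; apply: xgetPN => m [e eP]; apply: nfin; exists m, e.
Qed.

Hypothesis finFE : finite_extension F E.

Lemma is_mulmx_uniq x (A B : 'M[K]_(ext_degree F E)) :
  is_mulmx x A -> is_mulmx x B -> A = B.
Proof.
move=> [/mxOverP AF eA] [/mxOverP BF eB]; apply/matrixP => i j.
have [_ _ free] := ext_basisP finFE.
apply/subr0_eq; apply: (free (fun j => A i j - B i j)) => [l|].
  by rewrite rpredB.
under eq_bigr do rewrite mulrBl.
by rewrite sumrB -eA -eB subrr.
Qed.

Lemma mul_matrixP x : x \in E -> is_mulmx x (mul_matrix F E x).
Proof.
move=> xE; rewrite /mul_matrix; apply: xgetPex.
have [eE span _] := ext_basisP finFE.
have H i : exists c : 'I_(ext_degree F E) -> K, (forall j, c j \in F) /\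
    x * @ext_basis K F E i = \sum_j c j * @ext_basis K F E j.
  have [c cF ec] := span _ (rpredM xE (eE i)).
  by exists c.
have [c cP] := choice H.
exists (\matrix_(i, j) c i j); split.
  by apply/mxOverP => i j; rewrite mxE; exact: (cP i).1.
by move=> i; rewrite (cP i).2; apply: eq_bigr => j _; rewrite mxE.
Qed.

End TraceAdditive.

Lemma ext_traceB (K : fieldType) (F E : divringClosed K) x y :
  x \in E -> y \in E ->
  ext_trace F E (x - y) = ext_trace F E x - ext_trace F E y.
Proof.
move=> xE yE; have [fin|/ext_degree_infinite d0] := pselect (finite_extension F E).
  rewrite /ext_trace -raddfB /=; congr (\tr _).
  apply: (is_mulmx_uniq fin); first by apply: mul_matrixP; rewrite ?rpredB.
  have [/mxOverP xF ex] := mul_matrixP fin xE.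
  have [/mxOverP yF ey] := mul_matrixP fin yE.
  split; first by apply/mxOverP => i j; rewrite !mxE rpredB.
  move=> i; rewrite mulrBl ex ey -sumrB.
  by apply: eq_bigr => j _; rewrite !mxE mulrBl.
have tr0 (A : 'M[K]_(ext_degree F E)) : \tr A = 0.
  by rewrite /mxtrace big1 // => i; have := ltn_ord i; rewrite [X in (_ < X)%N]d0.
by rewrite /ext_trace !tr0 subrr.
Qed.

Section Kbar.
Variables (R : realType) (K : fieldType) (T : local_tower R K).

Lemma tower_mapB n nu x y : x \in layer T nu -> y \in layer T nu ->
  tower_map T n nu (x - y) = tower_map T n nu x - tower_map T n nu y.
Proof.
by move=> xl yl; rewrite /tower_map; case: ifP => // _; rewrite ext_traceB// mulrBr.
Qed.

Fact Kbar_zmod_closed : zmod_closed (Kbar_pred T).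
Proof.
split.
  apply/asboolP; split=> [n|n nu _]; first exact: rpred0.
  have /= := @tower_mapB n nu 0 0 (rpred0 _) (rpred0 _).
  by rewrite subr0 subrr => ->.
move=> x y /asboolP[xl xT] /asboolP[yl yT]; apply/asboolP.
split=> [n|n nu nnu]; first by rewrite rpredB.
by rewrite [RHS]tower_mapB -?xT -?yT.
Qed.

HB.instance Definition _ :=
  GRing.isZmodClosed.Build (nat -> K) (Kbar_pred T) Kbar_zmod_closed.

Record Kbar := MkKbar { kseq :> nat -> K; _ : kseq \in Kbar_pred T }.

HB.instance Definition _ := [isSub for kseq].
HB.instance Definition _ := [Choice of Kbar by <:].
HB.instance Definition _ := [SubChoice_isSubZmodule of Kbar by <:].
HB.instance Definition _ := isPointed.Build Kbar 0.

(* Topology of the seminorms x |-> tnorm T (x n). *)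
Definition Kbar_open : set (set Kbar) := [set U : set Kbar | forall x : Kbar, U x ->
  exists (N : nat) (eps : R), 0 < eps /\
    forall y : Kbar, (forall n, (n <= N)%N -> tnorm T (y n - x n) < eps) -> U y].

Fact Kbar_openT : Kbar_open setT.
Proof. by move=> x _; exists 0%N, 1. Qed.

Fact Kbar_openI : setI_closed Kbar_open.
Proof.
move=> U V oU oV x [Ux Vx].
have [N [e [e0 NeU]]] := oU x Ux; have [M [d [d0 MdV]]] := oV x Vx.
exists (maxn N M), (Num.min e d); split; first by rewrite lt_min e0.
move=> y yx; split; [apply: NeU|apply: MdV] => n nN;
  have := yx n; rewrite leq_max nN ?orbT lt_min => /(_ isT) /andP[//].
Qed.

Fact Kbar_open_bigU (I : Type) (f : I -> set Kbar) :
  (forall i, Kbar_open (f i)) -> Kbar_open (\bigcup_i f i).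
Proof.
move=> fo x [i _ fix_]; have [N [e [e0 H]]] := fo i x fix_.
by exists N, e; split=> // y /H fy; exists i.
Qed.

HB.instance Definition _ :=
  isOpenTopological.Build Kbar Kbar_openT Kbar_openI Kbar_open_bigU.

Definition Kborel := g_sigma_algebraType (@open Kbar).

(* For xi \in layer T n; the value lies in k and does not depend on n. *)
Definition pairing (n : nat) (xi : K) (y : Kbar) : K := tower_map T 0 n (xi * y n).

Definition compactS : set Kbar := [set x | forall n,
  tnorm T (x n) <= (lq T n)%:R `^ ((ldiff T n)%:~R / (ldeg T n)%:R)
                   * tnorm T (ldeg T n)%:R].

(* Here N is the index of the subgroup S_N with respect to the numbering
   K_1 = k, K_2, etc.: S_0 = S, and S_{n+1} constrains the component in
   K_{n+1} = layer T n. *)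
Definition subS (N : nat) : set Kbar :=
  if N is n.+1 then compactS `&` [set x |
    tnorm T (x n) <= (lq T n)%:R `^ ((ldiff T n)%:~R / (ldeg T n)%:R
                                     - n.+1%:R / (linert T n)%:R)
                     * tnorm T (ldeg T n)%:R]
  else compactS.

End Kbar.

HB.instance Definition _ (R : realType) (K : fieldType) (T : local_tower R K) :=
  Measurable.on (Kborel T).

Section Process.
Variables (R : realType) (K : fieldType) (T : local_tower R K).
Local Notation Kbar := (Kbar T).
Local Notation Kborel := (Kborel T).

(* A character of k = layer T 0; the values of chi elsewhere are irrelevant. *)
Record rank_zero_character (chi : K -> R[i]) : Prop := RankZeroCharacter {
  rzc_unitary : forall x, x \in layer T 0 -> `|chi x| = 1;
  rzc_add : forall x y, x \in layer T 0 -> y \in layer T 0 ->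
    chi (x + y) = chi x * chi y;
  rzc_cont : forall x, x \in layer T 0 -> forall eps : R, 0 < eps ->
    exists2 delta : R, 0 < delta & forall y, y \in layer T 0 ->
      labs T 0 (y - x) < delta -> `|chi y - chi x| < eps%:C%C;
  rzc_trivial : forall x, x \in layer T 0 -> labs T 0 x <= 1 -> chi x = 1;
  rzc_rank0 : exists2 x, x \in layer T 0 &
    labs T 0 x <= (lq T 0)%:R /\ chi x <> 1 }.

Definition Cintegral d (M : measurableType d) (mu : {measure set M -> \bar R})
    (f : M -> R[i]) : R[i] :=
  (Rintegral mu setT (fun x => complex.Re (f x)) +i*
   Rintegral mu setT (fun x => complex.Im (f x)))%C.

Definition radon (mu : probability Kborel R) : Prop :=
  forall A : set Kborel, measurable A ->
    mu A = ereal_sup [set mu C | C in [set C | compact (C : set Kbar) /\ C `<=` A]].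

Record stable_semigroup (chi : K -> R[i]) (alpha : R)
    (mu : R -> probability Kborel R) : Prop := StableSemigroup {
  ssg_radon : forall t : R, 0 < t -> radon (mu t);
  ssg_conv : forall s t : R, 0 < s -> 0 < t -> forall A : set Kborel, measurable A ->
    mu (s + t) A = (mu s \x mu t)%E [set p | A ((p.1 : Kbar) + (p.2 : Kbar))];
  ssg_supp : forall t : R, 0 < t -> mu t (compactS (T := T)) = 1%E;
  ssg_fourier : forall t : R, 0 < t -> forall n xi, xi \in layer T n ->
    Cintegral (mu t) (fun x : Kborel => chi (pairing n xi x)) =
      if 1 < tnorm T xi then (expR (- t * tnorm T xi `^ alpha))%:C%C else 1 }.

Record levy_process (mu : R -> probability Kborel R) (d : measure_display)
    (Om : measurableType d) (P : probability Om R) (X : R -> Om -> Kbar)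
    : Prop := LevyProcess {
  levy_mfun : forall t : R, 0 <= t -> measurable_fun setT (X t : Om -> Kborel);
  levy_S : forall (t : R) (w : Om), 0 <= t -> compactS (X t w);
  levy_0 : forall w, X 0 w = 0;
  levy_indep : forall (n : nat) (t : nat -> R) (A : nat -> set Kborel),
    0 <= t 0%N -> nondecreasing_seq t -> (forall i, measurable (A i)) ->
    P [set w | forall i, (i < n)%N -> A i (X (t i.+1) w - X (t i) w)] =
    (\big[*%E/1]_(i < n) P [set w | A i (X (t i.+1) w - X (t i) w)%R])%E;
  levy_stat : forall s h : R, 0 <= s -> 0 <= h ->
    forall A : set Kborel, measurable A ->
    P [set w | A (X (s + h) w - X s w)] = P [set w | A (X h w)];
  levy_right : forall (t : R) (w : Om), 0 <= t -> X s w @[s --> t^'+] --> X t w;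
  levy_left : forall (t : R) (w : Om), 0 < t -> exists l : Kbar, X s w @[s --> t^'-] --> l;
  levy_law : forall t : R, 0 < t -> forall A : set Kborel, measurable A ->
    P [set w | A (X t w)] = mu t A }.

(* exit_time X n w = +oo if the path never leaves S_n. *)
Definition exit_time (Om : Type) (X : R -> Om -> Kbar) (n : nat) (w : Om) : \bar R :=
  ereal_inf [set t%:E | t in [set t | 0 <= t /\ ~ subS n (X t w)]].

Definition Qprob (d : measure_display) (Om : measurableType d)
    (P : probability Om R) (X : R -> Om -> Kbar) (n N : nat) : \bar R :=
  P [set w | forall t : R, (exit_time X n w <= t%:E < exit_time X N w)%E ->
               ~ subS n (X t w)].

End Process.

(* Main.v *)
Require Import Defs.
From HB Require Import structures.
From mathcomp Require Import all_boot all_order all_algebra.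
From mathcomp Require Import all_classical all_reals all_analysis.
From mathcomp Require Import finmap complex ring lra zify.

(** The subgroup S_(n+1) is the annihilator in S of the ball
    {xi : |xi|_n <= q^D} of K_(n+1), where q = q_(n+1) and D >= n + 1.  Summing
    characters over this ball modulo the integers gives the exact return law
      P(X(t) in S_(n+1)) = F(t)
        = q^-D (1 + sum_(1 <= i <= D) (q^i - q^(i-1)) exp(-t q^(i alpha/m))).
    Off an event of probability at most P(X(1) in S_N)^M, the process leaves S_N
    before time M.  On the remaining event a return to S_(n+1) is, by right
    continuity, a return along some dyadic grid of step h; its probability is at
    most the expected number of steps from outside S_(n+1) into it, that is
      sum_j (F((j+1)h) - F(jh) F(h)) = (1 - F(h)) sum_j F(jh) + F(M) - 1.
    Almost all of the mass of F sits near the largest rate and m -> oo, so this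
    is at most 1/3 + F(M) + o(1) as n -> oo, uniformly in h. *)

Set Implicit Arguments.
Unset Strict Implicit.
Unset Printing Implicit Defensive.
Import Order.TTheory GRing.Theory Num.Theory.
Import numFieldNormedType.Exports.
Local Open Scope classical_set_scope.
Local Open Scope ring_scope.

(** * Degrees over a subfield *)

(** Two obstacles shape the estimate. [F(t)] tends to [q^-D > 0], so over unbounded time the
    expected number of re-entries is infinite: the exit from [S_N] before [M] supplies a finite
    horizon, at the cost of an error [M q^-D v^D], where [v = q^(alpha/m)]. And the number of grid
    points in [[0, M]] explodes as [h -> 0], so the factor [1 - F(h)] has to compensate. Apart from
    the constant [q^-D], [F] is a mixture of exponentials with weights [w_i = q^-D (q^i - q^(i-1))]
    at the rates [v^i]. Now [1 - F(h) <= 1 - exp(-h v^D)], concavity trades this for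
    [v^(D-i) (1 - exp(-h v^i))], and the last factor cancels the geometric sum over [j]. What
    remains, the sum of [w_i v^(D-i)], is at most [(1 - 1/q) / (1 - v/q)]. Once [m >= 4 alpha],
    [v^4 <= q], hence [4 v <= v^4 + 3 <= q + 3]; this one inequality bounds the quotient by 4/3 and
    [v/q] by 5/8. The 1/3 is [4/3 - 1], and three errors below 1/6 leave probability at least
    1/6. *)

Section Subfield.
Variables (K : fieldType) (F : divringClosed K).

(** Bundling the subset as a field of its own gives access to matrix rank and kernels with
    coefficients in [F]. *)
Record subfield := Subfield { subfield_val :> K; _ : subfield_val \in F }.

HB.instance Definition _ := [isSub for subfield_val].
HB.instance Definition _ := [Choice of subfield by <:].
HB.instance Definition _ := [SubChoice_isSubComUnitRing of subfield by <:].
HB.instance Definition _ := [SubComUnitRing_isSubIntegralDomain of subfield by <:].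
HB.instance Definition _ := [SubIntegralDomain_isSubField of subfield by <:].

End Subfield.

Section SubfieldSpan.
Variables (K : fieldType) (F : divringClosed K).
Local Notation subfield := (subfield F).

(** If [n < m], the coordinate matrix of the [e i] has a nonzero left kernel vector, which is a
    forbidden relation. Stated for families, it serves both to compare bases and to bound residue
    degrees. *)
Lemma free_span_leq (m n : nat) (e : 'I_m -> K) (b : 'I_n -> K) :
  (forall c : 'I_m -> K, (forall i, c i \in F) ->
     \sum_i c i * e i = 0 -> forall i, c i = 0) ->
  (forall i, exists2 c : 'I_n -> K, forall j, c j \in F & e i = \sum_j c j * b j) ->
  (m <= n)%N.
Proof.
move=> free span.
have [A AP] : exists A : 'M[subfield]_(m, n), forall i, e i = \sum_j val (A i j) * b j.
  have H i : exists c : 'I_n -> subfield, e i = \sum_j val (c j) * b j.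
    have [c cF ->] := span i.
    by exists (fun j => Subfield (cF j)).
  have [c cP] := choice H.
  by exists (\matrix_(i, j) c i j) => i; rewrite cP; apply: eq_bigr => j _; rewrite mxE.
rewrite leqNgt; apply/negP => ltnm.
have [v vA v0] : exists2 v : 'rV_m, v *m A = 0 & v != 0.
  have : kermx A != 0.
    rewrite kermx_eq0 /row_free neq_ltn.
    by rewrite (leq_ltn_trans (rank_leq_col A) ltnm).
  by move=> /rowV0Pn[v /sub_kermxP vA v0]; exists v.
case/negP: v0; apply/eqP/rowP => i; rewrite !mxE; apply: val_inj => /=.
apply: (free (fun i => val (v 0 i))) => [j|]; first exact: valP.
under eq_bigr do rewrite AP mulr_sumr.
rewrite exchange_big big1 // => j _.
transitivity (val ((v *m A) 0 j) * b j); last by rewrite vA mxE mul0r.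
rewrite mxE raddf_sum mulr_suml; apply: eq_bigr => k _.
by rewrite /= mulrA.
Qed.

Lemma basis_over_degree (E : divringClosed K) (m : nat) (e : 'I_m -> K) :
  finite_extension F E -> basis_over F E e -> ext_degree F E = m.
Proof.
move=> /ext_basisP[bE bspan bfree] [eE espan efree].
apply/eqP; rewrite eqn_leq; apply/andP; split.
  by apply: (free_span_leq bfree) => i; apply: espan.
by apply: (free_span_leq efree) => i; apply: bspan.
Qed.

Lemma ext_degree_self : finite_extension F F -> ext_degree F F = 1%N.
Proof.
move=> fin; apply: (@basis_over_degree _ _ (fun=> 1)) => //; split.
- by move=> _; rewrite rpred1.
- by move=> x xF; exists (fun=> x) => //; rewrite big_ord1 mulr1.
- by move=> c _; rewrite big_ord1 mulr1 => c0 i; rewrite (ord1 i).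
Qed.

(** Adjoin [x] to a basis of [E]: in a relation the coefficient of [x] vanishes, for otherwise [x]
    would lie in [E]. Along the strict tower this makes the degrees tend to infinity. *)
Lemma ext_degree_ltn (E E' : divringClosed K) :
  finite_extension F E -> finite_extension F E' -> {subset F <= E} ->
  {subset E <= E'} -> (exists2 x, x \in E' & x \notin E) ->
  (ext_degree F E < ext_degree F E')%N.
Proof.
move=> /ext_basisP[bE bspan bfree] /ext_basisP[bE' bspan' _] sFE sEE' [x xE' xE].
pose e (i : 'I_(ext_degree F E).+1) := oapp (@ext_basis K F E) x (unlift ord_max i).
have e_lift j : e (lift ord_max j) = ext_basis j by rewrite /e liftK.
have e_max : e ord_max = x by rewrite /e unlift_none.
apply: (@free_span_leq _ _ e (@ext_basis K F E')) => [c cF|i]; last first.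
  by apply: bspan'; rewrite /e; case: unliftP => [j|] _ //=; apply: sEE'.
rewrite big_ord_recr /= e_max.
have -> : \sum_(i < ext_degree F E) c (widen_ord (leqnSn _) i) * e (widen_ord (leqnSn _) i)
    = \sum_i c (lift ord_max i) * @ext_basis K F E i.
  apply: eq_bigr => i _; rewrite -e_lift.
  have -> // : widen_ord (leqnSn _) i = lift ord_max i.
  by apply: val_inj; rewrite /= /bump leqNgt ltn_ord.
move=> ce0; have cmax : c ord_max = 0.
  apply/eqP; apply: contraNT xE => cmax.
  have -> : x = - (c ord_max)^-1 * \sum_i c (lift ord_max i) * @ext_basis K F E i.
    apply: (mulfI cmax); rewrite mulrA mulrN divff // mulN1r.
    by apply/eqP; rewrite -addr_eq0 addrC ce0.
  apply: rpredM; first by rewrite rpredN rpredV; exact: sFE.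
  by apply: rpred_sum => i _; apply: rpredM => //; exact: sFE.
move=> i; case: (unliftP ord_max i) => [j ->|-> //].
apply: (bfree (fun i => c (lift ord_max i)) _ _ j) => //.
by move: ce0; rewrite cmax mul0r addr0.
Qed.

End SubfieldSpan.

(** * The absolute value on the tower *)

Section Ultrametric.
Variables (R : realType) (K : fieldType) (a : K -> R).
Hypothesis na : nonarch_abs predT a.

Lemma uabs_ge0 x : 0 <= a x. Proof. exact: (nonarch_ge0 na). Qed.

Lemma uabs_eq0 x : (a x == 0) = (x == 0).
Proof. by apply/eqP/eqP => /(nonarch_eq0 na (isT : x \in predT)). Qed.

Lemma uabsM x y : a (x * y) = a x * a y. Proof. exact: (nonarch_mul na). Qed.

Lemma uabsD x y : a (x + y) <= Num.max (a x) (a y).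
Proof. exact: (nonarch_add na). Qed.

Lemma uabs0 : a 0 = 0. Proof. by apply/eqP; rewrite uabs_eq0. Qed.

Lemma uabs_gt0 x : (0 < a x) = (x != 0).
Proof. by rewrite lt_def uabs_ge0 uabs_eq0 andbT. Qed.

Lemma uabs1 : a 1 = 1.
Proof.
have a1 : a 1 != 0 by rewrite uabs_eq0 oner_neq0.
by apply: (mulfI a1); rewrite -uabsM !mulr1.
Qed.

Lemma uabsN x : a (- x) = a x.
Proof.
suff aN1 : a (-1) = 1 by rewrite -mulN1r uabsM aN1 mul1r.
have /eqP : a (-1) ^+ 2 = 1 by rewrite expr2 -uabsM mulrNN mulr1 uabs1.
rewrite sqrf_eq1 => /orP[/eqP //|/eqP aN1].
by have := uabs_ge0 (-1); rewrite aN1 ler0N1.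
Qed.

Lemma uabs_distC x y : a (x - y) = a (y - x).
Proof. by rewrite -uabsN opprB. Qed.

Lemma uabsV x : a x^-1 = (a x)^-1.
Proof.
have [->|x0] := eqVneq x 0; first by rewrite invr0 uabs0 invr0.
have ax0 : a x != 0 by rewrite uabs_eq0.
by apply: (mulfI ax0); rewrite -uabsM !divff // uabs1.
Qed.

Lemma uabsB_le x y r : a x <= r -> a y <= r -> a (x - y) <= r.
Proof.
by move=> xr yr; apply: (le_trans (uabsD _ _)); rewrite ge_max uabsN xr.
Qed.

Lemma uabsD_le x y r : a x <= r -> a y <= r -> a (x + y) <= r.
Proof. by move=> xr yr; apply: (le_trans (uabsD _ _)); rewrite ge_max xr. Qed.

Lemma uabsD_lt x y r : a x < r -> a y < r -> a (x + y) < r.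
Proof. by move=> xr yr; apply: (le_lt_trans (uabsD _ _)); rewrite gt_max xr. Qed.

Lemma uabsB_lt x y r : a x < r -> a y < r -> a (x - y) < r.
Proof. by move=> xr yr; apply: uabsD_lt; rewrite ?uabsN. Qed.

Lemma uabsD_eq x y : a x < a y -> a (x + y) = a y.
Proof.
move=> xy; apply/le_anti/andP; split; first by apply: uabsD_le => //; exact: ltW.
rewrite leNgt; apply/negP => H.
by have := uabsB_lt H xy; rewrite addrAC subrr add0r ltxx.
Qed.

Lemma uabs_sum_le (I : Type) (s : seq I) (P : pred I) (f : I -> K) r :
  0 <= r -> (forall i, P i -> a (f i) <= r) -> a (\sum_(i <- s | P i) f i) <= r.
Proof.
move=> r0 fr; elim/big_ind: _ => //; first by rewrite uabs0.
by move=> x y; exact: uabsD_le.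
Qed.

End Ultrametric.

Section TowerNorm.
Variables (R : realType) (K : fieldType) (T : local_tower R K).
Local Notation N := (tnorm T).
Local Notation L := (layer T).

Lemma layer_le n m x : (n <= m)%N -> x \in L n -> x \in L m.
Proof.
move=> /subnK <-; elim: (m - n)%N => // k IH /IH; rewrite addSn.
exact: tower_mono.
Qed.

Lemma layer0_sub n x : x \in L 0 -> x \in L n.
Proof. exact: layer_le. Qed.

Lemma common_layer x y : exists n, x \in L n /\ y \in L n.
Proof.
have [[n xn] [m ym]] := (tower_union T x, tower_union T y).
exists (maxn n m); split; [move: xn|move: ym]; apply: layer_le.
  exact: leq_maxl.
exact: leq_maxr.
Qed.

Lemma ldeg0 : ldeg T 0 = 1%N.
Proof. by rewrite /ldeg ext_degree_self //; exact: tower_finite. Qed.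

Lemma ldeg_ltn n : (ldeg T n < ldeg T n.+1)%N.
Proof.
apply: ext_degree_ltn; try exact: tower_finite.
- by move=> x; exact: layer0_sub.
- by move=> x; exact: tower_mono.
- exact: tower_strict.
Qed.

Lemma ldeg_gt n : (n < ldeg T n)%N.
Proof. by elim: n => [|n IH]; [rewrite ldeg0|exact: leq_trans (ldeg_ltn n)]. Qed.

Lemma ldeg_gt0 n : (0 < ldeg T n)%N.
Proof. exact: leq_ltn_trans (ldeg_gt n). Qed.

Lemma labs_ge0 n x : x \in L n -> 0 <= labs T n x.
Proof. exact: (nonarch_ge0 (lfn_abs (tower_local T n))). Qed.

Lemma tnorm_labs n x : x \in L n -> N x = labs T n x `^ (ldeg T n)%:R^-1.
Proof. exact: tower_norm. Qed.

Lemma labsE n x : x \in L n -> labs T n x = N x ^+ ldeg T n.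
Proof.
move=> xn; rewrite (tnorm_labs xn) -powR_mulrn ?powR_ge0 // -powRrM mulVf.
  by rewrite powRr1 // labs_ge0.
by rewrite pnatr_eq0 -lt0n ldeg_gt0.
Qed.

Lemma tnorm_layer0 x : x \in L 0 -> N x = labs T 0 x.
Proof. by move=> x0; rewrite (labsE x0) ldeg0 expr1. Qed.

(** Two elements of [K] share a layer, where the norm is a root of a normalized absolute value;
    roots are increasing, so the ultrametric inequality survives. *)
Lemma tnorm_nonarch : nonarch_abs predT N.
Proof.
split=> [x _|x _|x y _ _|x y _ _].
- by have [n xn] := tower_union T x; rewrite (tnorm_labs xn) powR_ge0.
- have [n xn] := tower_union T x; rewrite (tnorm_labs xn).
  have /(_ x xn) <- := nonarch_eq0 (lfn_abs (tower_local T n)).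
  split=> [/powR_eq0_eq0 //|->]; rewrite powR0 // invr_eq0 pnatr_eq0.
  by rewrite -lt0n ldeg_gt0.
- have [n [xn yn]] := common_layer x y.
  rewrite (tnorm_labs xn) (tnorm_labs yn) (tnorm_labs (rpredM xn yn)).
  have /(_ x y xn yn) -> := nonarch_mul (lfn_abs (tower_local T n)).
  by rewrite powRM ?labs_ge0.
- have [n [xn yn]] := common_layer x y.
  rewrite (tnorm_labs xn) (tnorm_labs yn) (tnorm_labs (rpredD xn yn)).
  have /(_ x y xn yn) := nonarch_add (lfn_abs (tower_local T n)).
  have mono : {in Num.nneg &, {homo (fun x : R => x `^ (ldeg T n)%:R^-1)
      : x y / x <= y}} by apply: ge0_ler_powR; rewrite invr_ge0.
  rewrite le_max => /orP[] h; rewrite le_max; apply/orP; [left|right];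
    by apply: mono => //; rewrite nnegrE labs_ge0 // rpredD.
Qed.

End TowerNorm.

(** * Boundedness of the trace *)

Section NormEquivalence.
Variables (R : realType) (K : fieldType) (a : K -> R) (F : divringClosed K).
Hypothesis (na : nonarch_abs predT a) (cF : abs_complete F a).

(** Equivalence of norms over a complete field, by induction on the number of vectors. Its use is
    the boundedness of the trace. Indexing by [nat] lets the induction drop the last vector without
    casts. *)
Lemma coord_bound (m : nat) (e : nat -> K) :
  (forall c : nat -> K, (forall i, c i \in F) ->
     \sum_(i < m) c i * e i = 0 -> forall i, (i < m)%N -> c i = 0) ->
  exists2 C : R, 0 < C & forall c : nat -> K, (forall i, c i \in F) ->
    forall i, (i < m)%N -> a (c i) <= C * a (\sum_(i < m) c i * e i).
Proof.
elim: m => [|m IH] free; first by exists 1.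
have [|C C0 CP] := IH.
  move=> c cF0 c0 i im.
  pose c' k := if (k < m)%N then c k else 0.
  have := free c' _ _ i (ltnW im); rewrite /c' im; apply.
    by move=> k; case: ifP => // _; rewrite rpred0.
  rewrite big_ord_recr /= ltnn mul0r addr0 -[RHS]c0; apply: eq_bigr => k _.
  by rewrite ltn_ord.
(* The last vector has positive distance to the span of the others: otherwise approximating
   combinations have Cauchy coordinates by induction, and their limits [l i] in the complete [F]
   express [e m] through the other vectors. *)
have [del del0 delP] : exists2 del : R, 0 < del &
    forall c : nat -> K, (forall i, c i \in F) ->
      del <= a (e m + \sum_(i < m) c i * e i).
  apply: contrapT => /forall2NP nodel.
  have H k : exists c : nat -> K, (forall i, c i \in F) /\
      a (e m + \sum_(i < m) c i * e i) < k.+1%:R^-1.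
    case: (nodel k.+1%:R^-1) => [|]; first by rewrite invr_gt0 ltr0n.
    move=> /existsNP[c /not_implyP[cf /negP]]; rewrite -ltNge => clt.
    by exists c.
  have [c cP] := choice H.
  have inv_small (eps : R) : 0 < eps -> exists N0, forall k, (N0 <= k)%N -> k.+1%:R^-1 < eps.
    move=> eps0; exists (Num.truncn eps^-1) => k kN.
    rewrite invf_plt ?posrE ?ltr0n //; apply: lt_le_trans (truncnS_gt _) _.
    by rewrite ler_nat ltnS.
  have lim i : (i < m)%N -> exists l, l \in F /\ (fun n => a (c n i - l)) @ \oo --> (0 : R).
    move=> im; have [||l lF lP] := cF (u := fun n => c n i); last by exists l.
      by move=> n; apply: (cP n).1.
    move=> eps eps0; have [N0 N0P] := inv_small (eps / C) (divr_gt0 eps0 C0).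
    exists N0 => k l kN lN.
    apply: le_lt_trans (CP (fun i => c k i - c l i) _ i im) _.
      by move=> j; rewrite rpredB //; [exact: (cP k).1|exact: (cP l).1].
    rewrite mulrC -ltr_pdivlMr //.
    under eq_bigr do rewrite mulrBl.
    rewrite sumrB.
    rewrite (_ : _ - _ = (e m + \sum_(i < m) c k i * e i) - (e m + \sum_(i < m) c l i * e i)).
      by apply: uabsB_lt => //; [exact: lt_trans (cP k).2 (N0P _ kN)|
        exact: lt_trans (cP l).2 (N0P _ lN)].
    by rewrite opprD addrACA subrr add0r.
  have H' i : exists l, l \in F /\ ((i < m)%N -> (fun n => a (c n i - l)) @ \oo --> (0 : R)).
    case: (ltnP i m) => [im|_]; last by exists 0; rewrite rpred0.
    by have [l [lF lP]] := lim i im; exists l.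
  have [l lP] := choice H'.
  have em0 : a (e m + \sum_(i < m) l i * e i) = 0.
    apply/eqP; rewrite eq_le uabs_ge0 // andbT; apply/ler_addgt0Pr => eps eps0.
    rewrite add0r.
    have [N0 N0P] := inv_small eps eps0.
    have near_ok (i : 'I_m) : \forall n \near \oo, a (c n i - l i) * a (e i) < eps.
      have : (fun n => a (c n i - l i) * a (e i)) @ \oo --> (0 * a (e i)).
        by apply: cvgMl; apply: (lP i).2.
      rewrite mul0r => /cvgrPdist_lt /(_ eps eps0); apply: filterS => n.
      rewrite sub0r normrN; apply: le_lt_trans; exact: ler_norm.
    have /filter_ex[n [nN nP]] : \forall n \near \oo, (N0 <= n)%N /\
        forall i : 'I_m, a (c n i - l i) * a (e i) < eps.
      apply: filterI; first exact: nbhs_infty_ge.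
      exact: (filter_forall _ near_ok).
    rewrite (_ : _ + _ = (e m + \sum_(i < m) c n i * e i) - \sum_(i < m) (c n i - l i) * e i).
      apply: uabsB_le => //; first by apply: ltW; exact: lt_trans (cP n).2 (N0P _ nN).
      apply: uabs_sum_le => // [|i _]; first exact: ltW.
      by rewrite uabsM //; apply: ltW.
    under [X in _ - X]eq_bigr do rewrite mulrBl.
    rewrite sumrB; ring.
  have := free (fun i => if (i < m)%N then l i else 1) _ _ m (ltnSn m).
  rewrite ltnn => free1; suff : 1 = 0 :> K by apply/eqP; rewrite oner_eq0.
  apply: free1 => [i|]; first by case: ifP => _; rewrite ?rpred1 //; exact: (lP i).1.
  rewrite big_ord_recr /= ltnn mul1r addrC; apply/eqP; rewrite -(uabs_eq0 na) -em0.
  apply/eqP; congr (a (_ + _)); apply: eq_bigr => i _; by rewrite ltn_ord.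
have em_pos := uabs_ge0 na (e m).
(* [D] is the cost of removing the last term: [a (x - c m * e m) <= D * a x]. *)
pose D := 1 + a (e m) / del.
have D1 : 1 <= D by rewrite /D lerDl divr_ge0 // ltW.
exists (del^-1 + C * D).
  by apply: addr_gt0; [rewrite invr_gt0|apply: mulr_gt0 => //; exact: lt_le_trans D1].
move=> c cf i; rewrite ltnS => im.
set x := \sum_(i < m.+1) c i * e i.
have x0 := uabs_ge0 na x.
have xE : x = \sum_(i < m) c i * e i + c m * e m by rewrite /x big_ord_recr.
have cm : a (c m) <= del^-1 * a x.
  have [->|cm0] := eqVneq (c m) 0; first by rewrite uabs0 // mulr_ge0 // invr_ge0 ltW.
  (* Division by [c m] turns [x] into [e m] plus a combination, to which the distance bound
     applies. *)
  have := delP (fun i => (c m)^-1 * c i) (fun i => rpredM (rpredVr (cf m)) (cf i)).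
  under eq_bigr do rewrite -mulrA.
  rewrite -mulr_sumr (_ : _ + _ = (c m)^-1 * x); last first.
    by rewrite xE mulrDr mulKf // addrC.
  rewrite uabsM // uabsV // ler_pdivlMl ?uabs_gt0 // mulrC => h.
  by rewrite ler_pdivlMl.
have [im'|mi] := ltnP i m; last first.
  have -> : i = m by apply/eqP; rewrite eqn_leq im mi.
  apply: le_trans cm _; rewrite ler_wpM2r // lerDl.
  by apply: mulr_ge0; [exact: ltW|exact: le_trans ler01 D1].
apply: le_trans (CP c cf i im') _; rewrite mulrDl -mulrA.
apply: (@le_trans _ _ (C * (D * a x))); last first.
  by rewrite lerDr mulr_ge0 // invr_ge0 ltW.
rewrite ler_pM2l // (_ : \sum_(_ < _) _ = x - c m * e m); last by rewrite xE addrK.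
apply: uabsB_le => //; first by rewrite ler_peMl.
rewrite uabsM // /D mulrDl mul1r.
apply: (@le_trans _ _ (a (e m) / del * a x)); last by rewrite lerDr.
by rewrite mulrC -mulrA ler_wpM2l.
Qed.

End NormEquivalence.

Lemma ext_traceD (K : fieldType) (F E : divringClosed K) x y :
  x \in E -> y \in E ->
  ext_trace F E (x + y) = ext_trace F E x + ext_trace F E y.
Proof.
move=> xE yE; have t0 : ext_trace F E 0 = 0.
  by rewrite -[X in ext_trace _ _ X](subrr 0) ext_traceB ?rpred0 // subrr.
have tN : ext_trace F E (- y) = - ext_trace F E y.
  by rewrite -sub0r ext_traceB ?rpred0 // t0 sub0r.
by rewrite -{1}[y]opprK ext_traceB ?rpredN // tN opprK.
Qed.

Section Trace.
Variables (K : fieldType) (F E : divringClosed K).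
Hypotheses (finFE : finite_extension F E) (sFE : {subset F <= E}).

Lemma ext_traceZ c x : c \in F -> x \in E ->
  ext_trace F E (c * x) = c * ext_trace F E x.
Proof.
move=> cf xE; rewrite /ext_trace -mxtraceZ; congr (\tr _).
apply: (is_mulmx_uniq finFE).
  by apply: mul_matrixP => //; apply: rpredM => //; exact: sFE.
have [/mxOverP xF ex] := mul_matrixP finFE xE; split.
  by apply/mxOverP => i j; rewrite !mxE rpredM.
move=> i; rewrite -mulrA ex mulr_sumr; apply: eq_bigr => j _.
by rewrite mxE mulrA.
Qed.

Lemma ext_trace_base c : c \in F -> ext_trace F E c = c *+ ext_degree F E.
Proof.
move=> cf; rewrite /ext_trace -mxtrace_scalar; congr (\tr _).
apply: (is_mulmx_uniq finFE); first by apply: mul_matrixP => //; exact: sFE.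
split; first by apply/mxOverP => i j; rewrite !mxE; case: eqP; rewrite ?mulr1n ?mulr0n ?rpred0.
move=> i; rewrite (bigD1 i) //= mxE eqxx mulr1n big1 ?addr0 // => j ji.
by rewrite mxE eq_sym (negbTE ji) mulr0n mul0r.
Qed.

Lemma ext_trace_mem x : x \in E -> ext_trace F E x \in F.
Proof.
by move=> xE; have [/mxOverP xF _] := mul_matrixP finFE xE; exact: rpred_sum.
Qed.

(** The rows of the multiplication matrix are the coordinates of [x] times the basis vectors, so
    [coord_bound] controls each diagonal entry. *)
Lemma ext_trace_bound (R : realType) (a : K -> R) :
  nonarch_abs predT a -> abs_complete F a ->
  exists2 C : R, 0 < C & forall x, x \in E -> a (ext_trace F E x) <= C * a x.
Proof.
move=> na cF; have [bE _ bfree] := ext_basisP finFE.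
pose e (i : nat) : K := oapp (@ext_basis K F E) 0 (insub i).
have eE (i : 'I_(ext_degree F E)) : e i = ext_basis i by rewrite /e valK.
have [|C C0 CP] := @coord_bound R K a F na cF (ext_degree F E) e.
  move=> c cf c0 i im; apply: (bfree (fun i => c i) _ _ (Ordinal im)) => //.
  by rewrite -[RHS]c0; apply: eq_bigr => j _; rewrite eE.
have S0 : 0 <= \sum_(i < ext_degree F E) a (ext_basis i).
  by apply: sumr_ge0 => i _; exact: uabs_ge0.
exists (C * (1 + \sum_i a (@ext_basis K F E i))) => [|x xE].
  by rewrite mulr_gt0 // ltr_wpDr.
have [/mxOverP xF ex] := mul_matrixP finFE xE.
apply: uabs_sum_le => // [|i _].
  apply: mulr_ge0; last exact: uabs_ge0.
  by apply: mulr_ge0; [exact: ltW|exact: addr_ge0].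
pose c k := oapp (mul_matrix F E x i) 0 (insub k).
have cE (k : 'I_(ext_degree F E)) : c k = mul_matrix F E x i k by rewrite /c valK.
have cf k : c k \in F by rewrite /c; case: insub => [j|] /=; rewrite ?rpred0.
rewrite -cE; apply: le_trans (CP c cf i (ltn_ord i)) _.
rewrite (_ : \sum_(_ < _) _ = x * ext_basis i); last first.
  by rewrite ex; apply: eq_bigr => k _; rewrite cE eE.
rewrite -!mulrA ler_pM2l // uabsM // mulrC ler_wpM2r ?uabs_ge0 //.
rewrite (bigD1 i) //= addrCA lerDl addr_ge0 //.
by apply: sumr_ge0 => j _; exact: uabs_ge0.
Qed.

End Trace.

(** * Balls modulo the integers *)

Lemma residue_field_ext (R : realType) (K : fieldType) (F : divringClosed K)
    (a b : K -> R) :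
  {in F, a =1 b} -> residue_field F a = residue_field F b.
Proof.
move=> ab; have Oab : abs_integers F a = abs_integers F b.
  by apply/seteqP; split=> x [xF xa]; split; rewrite // ?ab // -ab.
rewrite /residue_field Oab; apply: eq_imagel => x [xF _].
apply/seteqP; split=> y [yF xy]; split=> //; last by rewrite ab // rpredB.
by rewrite -ab // rpredB.
Qed.

(** [labs T n] is controlled only on [layer T n]; this transport replaces it by a function that is
    an absolute value on all of [K]. *)
Lemma local_field_normalized_ext (R : realType) (K : fieldType)
    (F : divringClosed K) (a b : K -> R) :
  {in F, a =1 b} -> local_field_normalized F a -> local_field_normalized F b.
Proof.
move=> ab [[a1 a2 a3 a4] ac ar av].
have rE := residue_field_ext ab.
have cE : residue_card F a = residue_card F b by rewrite /residue_card rE.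
split; last 2 first.
- by rewrite -rE.
- rewrite -cE -av; apply/seteqP; split=> y [x [xF x0] <-]; exists x => //.
    by rewrite ab.
  by rewrite ab.
- split=> [x xF|x xF|x y xF yF|x y xF yF]; rewrite -?ab ?rpredM ?rpredD //.
  + exact: a1.
  + exact: a2.
  + exact: a3.
  + exact: a4.
- move=> u uF cau; have [|l lF lP] := ac u uF; last first.
    exists l => //; apply: cvg_trans lP; apply: near_eq_cvg; near=> n.
    by rewrite ab // rpredB.
  move=> eps eps0; have [N0 N0P] := cau eps eps0; exists N0 => m n mN nN.
  by rewrite ab ?N0P // rpredB.
Unshelve. all: by end_near. Qed.

Section LocalField.
Variables (R : realType) (K : fieldType) (F : divringClosed K) (a : K -> R).
Hypotheses (na : nonarch_abs predT a) (lf : local_field_normalized F a).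
Local Notation q := (residue_card F a).

Let residue_class_eq x y : x \in F -> y \in F ->
  residue_class F a x = residue_class F a y <-> a (x - y) < 1.
Proof.
move=> xF yF; split=> [xy|xy].
  have : residue_class F a y x by rewrite -xy; split; rewrite // subrr uabs0.
  by case.
apply/seteqP; split=> z [zF zx]; split=> //.
  by rewrite -(subrK x z) -addrA; exact: uabsD_lt.
by rewrite -(subrK y z) -addrA; apply: uabsD_lt => //; rewrite uabs_distC.
Qed.

(** The zero class is omitted so that all representatives are units; they become the leading digits
    in [ball_transversal]. *)
Lemma residue_reps : exists s : seq K,
  [/\ size s = q.-1, forall x, x \in s -> x \in F /\ a x = 1,
      uniq s, {in s &, forall x y, a (x - y) < 1 -> x = y}
    & forall x, x \in F -> a x <= 1 -> a x < 1 \/ exists2 y, y \in s & a (x - y) < 1].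
Proof.
have fin := lfn_residue lf.
pose cs := [seq C <- enum_fset (fset_set (residue_field F a)) | C != residue_class F a 0].
have csE C : (C \in cs) = (C != residue_class F a 0) && (C \in residue_field F a).
  by rewrite mem_filter -[X in _ && X]/(C \in fset_set _) in_fset_set.
pose rep C := xget 0 [set x | [/\ x \in F, a x <= 1 & residue_class F a x = C]].
have repP C : C \in cs -> [/\ rep C \in F, a (rep C) <= 1 & residue_class F a (rep C) = C].
  rewrite csE => /andP[_ /set_mem[x [xF x1] xC]].
  by rewrite /rep; case: xgetP => [y _ //|/(_ x)[]].
have ureps : {in cs &, injective rep}.
  move=> C D /repP[_ _ CE] /repP[_ _ DE] CD.
  by rewrite -CE -DE CD.
have csu : uniq cs by rewrite filter_uniq // fset_uniq.
exists (map rep cs); split.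
- rewrite size_map size_filter.
  have := count_predC (pred1 (residue_class F a 0)) (enum_fset (fset_set (residue_field F a))).
  rewrite count_uniq_mem ?fset_uniq // -[X in nat_of_bool X]/(_ \in fset_set _) in_fset_set //.
  rewrite mem_set /=; last by exists 0 => //; split; rewrite ?rpred0 // uabs0.
  by rewrite /residue_card => <-; rewrite add1n.
- move=> _ /mapP[C Ccs ->]; have [rF r1 rC] := repP C Ccs; split=> //.
  apply/eqP; rewrite eq_le r1 leNgt; apply/negP => r_lt.
  move: Ccs; rewrite csE -rC => /andP[/eqP + _]; apply.
  by apply/residue_class_eq; rewrite ?rpred0 // subr0.
- by rewrite map_inj_in_uniq.
- move=> _ _ /mapP[C Ccs ->] /mapP[D Dcs ->].
  have [CF _ CE] := repP C Ccs; have [DF _ DE] := repP D Dcs.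
  by move=> /(residue_class_eq CF DF); rewrite CE DE => ->.
- move=> x xF x1; have [x_lt|x_ge] := ltP (a x) 1; [by left|right].
  have xcs : residue_class F a x \in cs.
    rewrite csE; apply/andP; split; last by apply/mem_set; exists x.
    apply/eqP => /(residue_class_eq xF (rpred0 _)); rewrite subr0.
    by rewrite ltNge x_ge.
  exists (rep (residue_class F a x)); first exact: map_f.
  by have [rF _ /esym] := repP _ xcs; move/(residue_class_eq xF rF).
Qed.

Lemma residue_card_gt1 : (1 < q)%N.
Proof.
have [s [ss _ _ _ scov]] := residue_reps.
have a1 := uabs1 na.
have [||[y ys _]] := scov 1 (rpred1 _); rewrite ?a1 ?ltxx //.
have : (0 < size s)%N by case: s ys {ss scov}.
by rewrite ss; case: q => [|[]].
Qed.

Let q1 : (1 : R) < q%:R. Proof. by rewrite ltr1n residue_card_gt1. Qed.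
Let q0 : (0 : R) < q%:R. Proof. exact: lt_trans q1. Qed.

Lemma value_int x : x \in F -> x != 0 -> exists z : int, a x = q%:R ^ z.
Proof.
move=> xF x0; have : [set a x | x in [set x | x \in F /\ x != 0]] (a x) by exists x.
by rewrite (lfn_values lf) => -[z _ <-]; exists z.
Qed.

Lemma int_value (z : int) : exists x, [/\ x \in F, x != 0 & a x = q%:R ^ z].
Proof.
have : [set q%:R ^ z | z in [set: int]] (q%:R ^ z : R) by exists z.
by rewrite -(lfn_values lf) => -[x [xF x0] xz]; exists x.
Qed.

Lemma value_lt x (z : int) : x \in F -> a x < q%:R ^ (z + 1) -> a x <= q%:R ^ z.
Proof.
move=> xF; have [->|x0] := eqVneq x 0; first by rewrite uabs0 // exprz_ge0 // ltW.
have [w ->] := value_int xF x0.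
by rewrite ltr_eXz2l // ler_eXz2l // ltzD1.
Qed.

(** Digit expansion: stage [k + 1] adds the elements [r * w + x] with [a w = q^(k+1)], [r] a unit
    digit and [x] an old representative. All have absolute value exactly [q^(k+1)] and there are
    [(q - 1) q^k] of them, whence the weights in the sum of a radial function. *)
Lemma ball_transversal (k : nat) : exists s : seq K,
  [/\ forall x, x \in s -> x \in F /\ a x <= q%:R ^+ k,
      forall x, x \in F -> a x <= q%:R ^+ k -> exists2 y, y \in s & a (x - y) <= 1,
      uniq s, {in s &, forall x y, a (x - y) <= 1 -> x = y}
    & forall (g : K -> R) (h : nat -> R),
        (forall x, a x <= 1 -> g x = h 0%N) ->
        (forall x i, (0 < i)%N -> a x = q%:R ^+ i -> g x = h i) ->
        \sum_(x <- s) g x =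
          h 0%N + \sum_(1 <= i < k.+1) (q%:R ^+ i - q%:R ^+ i.-1) * h i].
Proof.
elim: k => [|k [s [sF scov suniq ssep ssum]]].
  exists [:: 0]; split=> //=.
  - by move=> x; rewrite inE => /eqP ->; rewrite rpred0 uabs0.
  - by move=> x xF x1; exists 0; rewrite ?inE // subr0.
  - by move=> x y; rewrite !inE => /eqP -> /eqP ->.
  - move=> g h g0 _; rewrite big_seq1 big_geq // addr0 g0 // uabs0 //; exact: ler01.
have [w [wF w0 aw]] := int_value k.+1%:Z.
have {}aw : a w = q%:R ^+ k.+1 by rewrite aw.
have [t [tsz tF tuniq tsep tcov]] := residue_reps.
pose u := [seq r * w + x | r <- t, x <- s].
have qk1 : (q%:R : R) ^+ k < q%:R ^+ k.+1 by rewrite ltr_eXn2l.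
have uP r x : r \in t -> x \in s -> a (r * w + x) = q%:R ^+ k.+1.
  move=> /tF[rF r1] /sF[xF xk]; have rw : a (r * w) = q%:R ^+ k.+1.
    by rewrite uabsM // r1 mul1r.
  by rewrite addrC uabsD_eq // rw (le_lt_trans xk).
have qk_ge1 j : (1 : R) <= q%:R ^+ j by rewrite exprn_ege1 // ltW.
have sep_aux r x r' x' : r \in t -> x \in s -> r' \in t -> x' \in s ->
    a (r * w + x - (r' * w + x')) <= 1 -> r = r' /\ x = x'.
  move=> rt xs rt' xs'.
  have [rF r1] := tF _ rt; have [xF xk] := sF _ xs.
  have [rF' r1'] := tF _ rt'; have [xF' xk'] := sF _ xs'.
  rewrite (_ : _ - _ = (r - r') * w + (x - x')); last by ring.
  move=> le1; have rr : r = r'.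
    apply: tsep => //.
    have : a ((r - r') * w) < q%:R ^+ k.+1.
      rewrite -(addrK (x - x') (_ * w)); apply: uabsB_lt => //.
        exact: le_lt_trans le1 (le_lt_trans (qk_ge1 k) qk1).
      apply: le_lt_trans qk1; exact: uabsB_le.
    by rewrite uabsM // aw -ltr_pdivlMr ?exprn_gt0 // divff // expf_neq0 // gt_eqF.
  split=> //; apply: ssep => //; move: le1.
  by rewrite rr subrr mul0r add0r.
have uuniq : uniq u.
  apply: allpairs_uniq => // -[r x] [r' x'] /allpairsP[[? ?] [/= rt xs [-> ->]]].
  move=> /allpairsP[[? ?] [/= rt' xs' [-> ->]]] /= e.
  have [|-> -> //] := sep_aux _ _ _ _ rt xs rt' xs'.
  by rewrite e subrr uabs0.
exists (s ++ u); split.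
- move=> x; rewrite mem_cat => /orP[/sF[xF xk]|/allpairsP[[r y] [/= rt ys ->]]].
    by split=> //; exact: le_trans xk (ltW qk1).
  split; last by rewrite uP.
  by have [[rF _] [yF _]] := (tF _ rt, sF _ ys); rewrite rpredD // rpredM.
- move=> x xF xk.
  have xwF : x / w \in F by rewrite rpred_div.
  have xw1 : a (x / w) <= 1.
    by rewrite uabsM // uabsV // ler_pdivrMr ?uabs_gt0 // mul1r aw.
  have cov y : y \in F -> a (y / w) < 1 -> exists2 z, z \in s & a (y - z) <= 1.
    move=> yF; rewrite uabsM // uabsV // ltr_pdivrMr ?uabs_gt0 // mul1r aw => yk.
    by apply: scov => //; apply: (@value_lt _ k%:Z) => //; rewrite -PoszD addn1.
  have [x_lt|[r rt rx]] := tcov _ xwF xw1.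
    by have [y ys xy] := cov x xF x_lt; exists y; rewrite ?mem_cat ?ys.
  have [rF _] := tF _ rt.
  have yF : x - r * w \in F by rewrite rpredB // rpredM.
  have [|y ys xy] := cov _ yF.
    by rewrite mulrBl mulfK.
  exists (r * w + y); last by rewrite opprD addrA.
  by rewrite mem_cat; apply/orP; right; apply/allpairsP; exists (r, y).
- rewrite cat_uniq suniq uuniq andbT; apply/hasPn => _ /allpairsP[[r x] [/= rt xs ->]].
  apply/negP => /sF[_]; rewrite uP //; by rewrite leNgt qk1.
- have cross x y : x \in s -> y \in u -> a (x - y) <= 1 -> False.
    move=> /sF[_ xk] /allpairsP[[r z] [/= rt zs ->]] h.
    have : a (r * w + z) <= q%:R ^+ k.
      rewrite -(subrK x (_ + _)); apply: uabsD_le => //; rewrite uabs_distC //.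
      exact: le_trans (qk_ge1 k).
    by rewrite uP // leNgt qk1.
  move=> x y; rewrite !mem_cat => /orP[xs|xu] /orP[ys|yu].
  + exact: ssep.
  + by move=> /cross-/(_ xs yu).
  + by rewrite uabs_distC // => /cross-/(_ ys xu).
  + move: xu yu => /allpairsP[[r z] [/= rt zs ->]] /allpairsP[[r' z'] [/= rt' zs' ->]].
    by move=> /sep_aux-/(_ rt zs rt' zs')[-> ->].
- move=> g h g0 gi; rewrite big_cat /= (ssum g h) // [in RHS]big_nat_recr //= addrA; congr (_ + _).
  have -> : \sum_(i <- u) g i = \sum_(i <- u) h k.+1.
    rewrite !big_seq; apply: eq_bigr => _ /allpairsP[[r x] [/= rt xs ->]].
    by rewrite (gi _ k.+1) // uP.
  (* The induction hypothesis for the constant function 1 counts the old representatives; the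
     weights telescope. *)
  have sz : (size s)%:R = q%:R ^+ k :> R.
    have := ssum (fun=> 1) (fun=> 1) (fun _ _ => erefl) (fun _ _ _ _ => erefl).
    rewrite big_const_seq iter_addr addr0 count_predT => ->.
    under eq_bigr do rewrite mulr1.
    rewrite (@telescope_sumr_eq _ _ _ (fun i => q%:R ^+ i.-1)) //=.
    by rewrite expr0 addrC subrK.
  rewrite big_const_seq iter_addr addr0 count_predT size_allpairs tsz.
  rewrite -[LHS]mulr_natl natrM sz exprS -subn1 natrB ?(ltnW residue_card_gt1) //; ring.
Qed.

End LocalField.

(** * Invariants of the layers *)

Lemma int_set_max (P : int -> Prop) (d0 D : int) :
  P d0 -> (forall d, P d -> d <= D) -> exists d, P d /\ forall d', P d' -> d' <= d.
Proof.
move=> Pd0 PD.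
suff H (k : nat) : forall d, P d -> D - d <= k%:Z ->
    exists d, P d /\ forall d', P d' -> d' <= d.
  by apply: (H `|D - d0|%N d0) => //; rewrite gez0_abs // subr_ge0; exact: PD.
elim: k => [|k IH] d Pd Dd.
  by exists d; split=> // d' /PD; move: Dd; rewrite lerBlDl addr0 => h /le_trans; apply.
have [[d' [Pd' dd']]|nd] := pselect (exists d', P d' /\ d < d').
  by apply: (IH d') => //; lia.
exists d; split=> // d' Pd'; rewrite leNgt; apply/negP => dd'; apply: nd.
by exists d'.
Qed.

Lemma natpow_unbounded (R : realType) (q : nat) (x : R) :
  (1 < q)%N -> exists k : nat, x < q%:R ^+ k.
Proof.
move=> q1; exists (Num.truncn x).+1; apply: lt_trans (truncnS_gt x) _.
by rewrite -natrX ltr_nat ltn_expl.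
Qed.

Section Layers.
Variables (R : realType) (K : fieldType) (T : local_tower R K).
Local Notation N := (tnorm T).
Local Notation L := (layer T).

(** The normalized absolute value of [layer T n], prolonged to all of [K]. *)
Definition nabs (n : nat) (x : K) : R := N x ^+ ldeg T n.

Lemma nabs_nonarch n : nonarch_abs predT (nabs n).
Proof.
have na := tnorm_nonarch T; have m0 := ldeg_gt0 T n.
split=> [x _|x _|x y _ _|x y _ _]; rewrite /nabs.
- by rewrite exprn_ge0 // uabs_ge0.
- split=> [/eqP|->]; last by rewrite uabs0 // expr0n gtn_eqF.
  by rewrite expf_eq0 m0 /= uabs_eq0 // => /eqP.
- by rewrite uabsM // exprMn.
- have := uabsD na x y; rewrite !le_max => /orP[] h; apply/orP; [left|right];
    by rewrite ler_pXn2r ?nnegrE ?uabs_ge0.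
Qed.

Lemma labs_nabs n : {in L n, labs T n =1 nabs n}.
Proof. by move=> x xn; rewrite labsE. Qed.

Lemma nabs_local n : local_field_normalized (L n) (nabs n).
Proof. exact: local_field_normalized_ext (@labs_nabs n) (tower_local T n). Qed.

Lemma lqE n : lq T n = residue_card (L n) (nabs n).
Proof. by rewrite /lq /residue_card (residue_field_ext (@labs_nabs n)). Qed.

Lemma lq_gt1 n : (1 < lq T n)%N.
Proof. by rewrite lqE (residue_card_gt1 (nabs_nonarch n)) //; exact: nabs_local. Qed.

Lemma lqR_gt1 n : 1 < (lq T n)%:R :> R.
Proof. by rewrite ltr1n lq_gt1. Qed.

Lemma lqR_gt0 n : 0 < (lq T n)%:R :> R.
Proof. exact: lt_trans ltr01 (lqR_gt1 n). Qed.

Lemma nabs0E x : nabs 0 x = N x.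
Proof. by rewrite /nabs ldeg0 expr1. Qed.

Lemma nabs_value n x : x \in L n -> x != 0 -> exists z : int, nabs n x = (lq T n)%:R ^ z.
Proof. by rewrite lqE; exact: (value_int (nabs_local n)). Qed.

Lemma nabs_int n (z : int) : exists x, [/\ x \in L n, x != 0 & nabs n x = (lq T n)%:R ^ z].
Proof. by rewrite lqE; exact: (int_value (nabs_local n)). Qed.

Lemma nabs_le n x (z : int) :
  x \in L n -> nabs n x < (lq T n)%:R ^ (z + 1) -> nabs n x <= (lq T n)%:R ^ z.
Proof. by rewrite lqE; exact: (value_lt (nabs_nonarch n) (nabs_local n)). Qed.

(** Linear independence of the residues of the [w i] over the residue field of [layer T 0],
    expressed on representatives. *)
Definition residue_free n (f : nat) (w : 'I_f -> K) : Prop :=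
  (forall i, abs_integers (L n) N (w i)) /\
  forall c : 'I_f -> K, (forall i, abs_integers (L 0) N (c i)) ->
    N (\sum_i c i * w i) < 1 -> forall i, N (c i) < 1.

(** Independent residues lift to independent vectors: a relation divided by its largest coefficient
    is integral with one coefficient equal to 1. *)
Lemma residue_free_leq n f (w : 'I_f -> K) : residue_free n w -> (f <= ldeg T n)%N.
Proof.
have na := tnorm_nonarch T.
move=> [wO wfree]; have [bE bspan bfree] := ext_basisP (tower_finite T n).
apply: (@free_span_leq _ (L 0) _ _ w (@ext_basis K (L 0) (L n))) => [c cF c0 i|i].
  apply/eqP; apply: contrapT => /negP ci0.
  have [j _ jmax] := @arg_maxP _ _ _ i xpredT (fun i => N (c i)) isT.
  have cj0 : c j != 0.
    by rewrite -(uabs_gt0 na); apply: lt_le_trans (jmax i isT); rewrite uabs_gt0.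
  suff : N (c j / c j) < 1 by rewrite divff // uabs1 // ltxx.
  apply: (wfree (fun i => c i / c j)) => [k|].
    split; first by rewrite rpred_div.
    by rewrite uabsM // uabsV // ler_pdivrMr ?uabs_gt0 // mul1r; exact: jmax.
  under eq_bigr do rewrite mulrAC.
  by rewrite -mulr_suml c0 mul0r uabs0.
by apply: bspan; exact: (wO i).1.
Qed.

(** Residue-free families have size at most the degree, so one of maximal size exists, and it
    spans. *)
Lemma residue_basis_exists n :
  exists f (w : 'I_f -> K), residue_basis (L 0) (L n) N w.
Proof.
have na := tnorm_nonarch T.
pose P f := exists w : 'I_f -> K, residue_free n w.
have [f [[w wP] nP]] : exists f, P f /\ ~ P f.+1.
  apply: contrapT => /forallNP nex.
  have all f : P f.
    elim: f => [|f IH]; first by exists (fun=> 0); split=> [[]|c _ _ []].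
    by apply: contrapT => nPf; apply: (nex f).
  have [w /residue_free_leq] := all (ldeg T n).+1.
  by rewrite ltnn.
exists f, w; have [wO wfree] := wP; split=> // x [xn x1].
pose w' (i : 'I_f.+1) := oapp w x (unlift ord_max i).
have w_lift j : w' (lift ord_max j) = w j by rewrite /w' liftK.
have w_max : w' ord_max = x by rewrite /w' unlift_none.
have sumE (c : 'I_f.+1 -> K) :
    \sum_i c i * w' i = \sum_i c (lift ord_max i) * w i + c ord_max * x.
  rewrite big_ord_recr /= w_max; congr (_ + _); apply: eq_bigr => i _.
  rewrite -w_lift; have -> // : widen_ord (leqnSn f) i = lift ord_max i.
  by apply: val_inj; rewrite /= /bump leqNgt ltn_ord.
have /not_andP[[]|] : ~ residue_free n w' by move=> h; apply: nP; exists w'.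
  by move=> i; rewrite /w'; case: unliftP => [j|] _ /=; [exact: wO|].
move=> /existsNP[c /not_implyP[cO /not_implyP[c_lt /existsNP[i ci]]]].
(* The coefficient of [x] is a unit, since otherwise a nontrivial relation among the residues of the
   [w i] would remain; one can therefore solve for [x]. *)
have clast : N (c ord_max) = 1.
  apply/eqP; rewrite eq_le (cO ord_max).2 leNgt; apply/negP => cm.
  have lt1 : N (\sum_i c (lift ord_max i) * w i) < 1.
    rewrite -(addrK (c ord_max * x) (\sum__ _)) -sumE; apply: uabsB_lt => //.
    rewrite uabsM //; apply: le_lt_trans cm.
    by rewrite ler_piMr // uabs_ge0.
  apply: ci; case: (unliftP ord_max i) => [j ->|-> //].
  exact: (wfree (fun j => c (lift ord_max j)) (fun j => cO _) lt1 j).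
have cm0 : c ord_max != 0 by rewrite -(uabs_eq0 na) clast oner_eq0.
exists (fun i => - (c ord_max)^-1 * c (lift ord_max i)) => [j|].
  split; first by rewrite rpredM // ?rpredN ?rpredV; [exact: (cO ord_max).1|exact: (cO _).1].
  by rewrite uabsM // uabsN // uabsV // clast invr1 mul1r; exact: (cO _).2.
under eq_bigr do rewrite -mulrA.
rewrite -mulr_sumr mulNr opprK.
have -> : x + (c ord_max)^-1 * (\sum_i c (lift ord_max i) * w i) =
    (c ord_max)^-1 * \sum_i c i * w' i by rewrite sumE mulrDr mulKf // addrC.
by rewrite uabsM // uabsV // clast invr1 mul1r.
Qed.

(** An empty residue basis would put 1 into the maximal ideal. The upper bound is what makes [depth]
    exceed [n]. *)
Lemma linert_bounds n : (0 < linert T n <= ldeg T n)%N.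
Proof.
have na := tnorm_nonarch T.
have [f fP] := residue_basis_exists n.
have : [set f | exists w : 'I_f -> K, residue_basis (L 0) (L n) N w] (linert T n).
  by rewrite /linert /inertia_index; apply: xgetPex; exists f.
move=> [w [wO wspan wfree]]; apply/andP; split; last exact: (@residue_free_leq n _ w).
rewrite lt0n; apply/eqP => f0.
have [|c _] := wspan 1; first by split; rewrite ?rpred1 // uabs1.
rewrite big1 => [|i _]; last by have := ltn_ord i; rewrite [X in (_ < X)%N]f0.
by rewrite subr0 uabs1 // ltxx.
Qed.

Lemma ltr_trace_mem n x : x \in L n -> ext_trace (L 0) (L n) x \in L 0.
Proof. exact: ext_trace_mem (tower_finite T n) _. Qed.

Lemma diff_boundE n d : diff_bound T n d <-> forall x, x \in L n ->
  nabs n x <= (lq T n)%:R ^ d -> N (ext_trace (L 0) (L n) x) <= 1.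
Proof.
split=> h x xn xd.
  by rewrite tnorm_layer0 ?ltr_trace_mem // h // labs_nabs.
by rewrite -tnorm_layer0 ?ltr_trace_mem // h // -labs_nabs.
Qed.

Lemma natr_neq0 m : (0 < m)%N -> m%:R != 0 :> K.
Proof.
by move=> m0; have [/(_ (tower_char0 T)) -> _] := pcharf0P K; rewrite -lt0n.
Qed.

(** Some exponent is admissible because the trace is bounded. Exponents are bounded above because
    [c] in [layer T 0] has trace [m c], not integral for large [c], as [m] is nonzero in
    characteristic 0. *)
Lemma ldiffP n : diff_bound T n (ldiff T n) /\
  forall d, diff_bound T n d -> d <= ldiff T n.
Proof.
have na := tnorm_nonarch T; have sub x := @layer0_sub _ _ T n x.
have fin := tower_finite T n; have m0 := ldeg_gt0 T n.
have Q1 := lqR_gt1 n; have Q0 := lqR_gt0 n.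
suff : [set d | diff_bound T n d /\ forall d', diff_bound T n d' -> d' <= d] (ldiff T n) by [].
rewrite /ldiff; apply: xgetPex.
have [d0 d0P] : exists d, diff_bound T n d.
  have cpl : abs_complete (L 0) N.
    have nE : {in L 0, nabs 0 =1 N} by move=> x _; rewrite nabs0E.
    exact: (lfn_complete (local_field_normalized_ext nE (nabs_local 0))).
  have [C C0 CP] := ext_trace_bound fin na cpl.
  (* With this [k], [nabs n x <= q^-k] forces [(C * N x)^m <= 1]. *)
  have [k kP] := natpow_unbounded (C ^+ ldeg T n) (lq_gt1 n).
  exists (- k%:Z); apply/diff_boundE => x xn; rewrite -exprnN => xk.
  apply: le_trans (CP x xn) _.
  rewrite -(@ler_pXn2r _ (ldeg T n)) ?nnegrE ?mulr_ge0 ?uabs_ge0 ?(ltW C0) // expr1n exprMn.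
  apply: (@le_trans _ _ (C ^+ ldeg T n * (lq T n)%:R ^- k)).
    by rewrite ler_pM2l ?exprn_gt0.
  by rewrite ler_pdivrMr ?exprn_gt0 // mul1r ltW.
have mK0 : N (ldeg T n)%:R > 0 by rewrite uabs_gt0 // natr_neq0.
have [j jP] := natpow_unbounded (N (ldeg T n)%:R)^-1 (lq_gt1 0).
have [c [c0 _ cj]] := nabs_int 0 j%:Z; rewrite nabs0E in cj.
have [D DP] := natpow_unbounded (nabs n c) (lq_gt1 n).
apply: (@int_set_max _ d0 D%:Z) => // d /diff_boundE dP.
rewrite leNgt; apply/negP => Dd.
have : N (ext_trace (L 0) (L n) c) <= 1.
  apply: dP; first exact: sub.
  by apply: le_trans (ltW DP) _; rewrite exprnP ler_eXz2l // ltW.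
rewrite ext_trace_base // -mulr_natr uabsM // cj leNgt => /negP; apply.
by rewrite -ltr_pdivrMr // div1r.
Qed.

Lemma diff_bound_le n d x : d <= ldiff T n -> x \in L n ->
  nabs n x <= (lq T n)%:R ^ d -> N (ext_trace (L 0) (L n) x) <= 1.
Proof.
move=> dl xn xd; have [/diff_boundE h _] := ldiffP n.
by apply: h => //; apply: le_trans xd _; rewrite ler_eXz2l // lqR_gt1.
Qed.

(** By maximality of the exponent [d], some [x] with [nabs n x <= q^(d+1)] has a non-integral trace;
    since values are powers of [q], [nabs n y] is at least [q^(d+1)], and [v = x / y] is
    integral. *)
Lemma diff_bound_sharp n y : y \in L n -> (lq T n)%:R ^ ldiff T n < nabs n y ->
  exists v, [/\ v \in L n, nabs n v <= 1 & 1 < N (ext_trace (L 0) (L n) (v * y))].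
Proof.
move=> yn yd; have nn := nabs_nonarch n; have [_ dmax] := ldiffP n.
have y0 : y != 0.
  by rewrite -(uabs_gt0 nn); apply: lt_trans yd; rewrite exprz_gt0 // lqR_gt0.
have /diff_boundE : ~ diff_bound T n (ldiff T n + 1).
  by move=> /dmax; rewrite leNgt ltzD1 lexx.
move=> /existsNP[x /not_implyP[xn /not_implyP[xd /negP]]]; rewrite -ltNge => trx.
exists (x / y); split; rewrite ?rpred_div ?divfK //.
rewrite uabsM // uabsV // ler_pdivrMr ?uabs_gt0 // mul1r.
apply: le_trans xd _; rewrite leNgt; apply/negP => /nabs_le-/(_ yn).
by rewrite leNgt yd.
Qed.

End Layers.

(** * The subgroups of S *)

Section KbarTopology.
Variables (R : realType) (K : fieldType) (T : local_tower R K).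
Local Notation N := (tnorm T).
Local Notation L := (layer T).
Local Notation Kbar := (Kbar T).
Local Notation Kborel := (Kborel T).

Lemma Kbar_mem (x : Kbar) n : x n \in L n.
Proof. by case: x => x /= /asboolP[]. Qed.

Lemma Kbar_open_cst (n : nat) (r : R) (A : set Kbar) : 0 < r ->
  (forall x y : Kbar, N (y n - x n) < r -> A x -> A y) -> open A.
Proof.
move=> r0 H; suff : Kbar_open A by [].
move=> x Ax; exists n, r; split=> // y /(_ n (leqnn n)) yx.
exact: H yx Ax.
Qed.

Lemma open_Kborel (A : set Kbar) : open A -> measurable (A : set Kborel).
Proof. exact: sub_sigma_algebra. Qed.

Definition ball_at (n : nat) (r : R) : set Kbar := [set x | N (x n) <= r].

Lemma ball_at_cst n r (x y : Kbar) :
  N (y n - x n) < r -> ball_at n r x -> ball_at n r y.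
Proof.
move=> yx Ax; rewrite /ball_at /= -(subrK (x n) (y n)).
by apply: (uabsD_le (tnorm_nonarch T)) => //; exact: ltW.
Qed.

Lemma ball_at_sub n r (x y : Kbar) :
  ball_at n r x -> ball_at n r y -> ball_at n r (x - y).
Proof. by move=> xb yb; exact: (uabsB_le (tnorm_nonarch T) xb yb). Qed.

Lemma ball_at_add n r (x y : Kbar) :
  ball_at n r x -> ball_at n r y -> ball_at n r (x + y).
Proof. by move=> xb yb; exact: (uabsD_le (tnorm_nonarch T) xb yb). Qed.

Lemma ldeg_tnorm_gt0 n : 0 < N (ldeg T n)%:R.
Proof.
by rewrite (uabs_gt0 (tnorm_nonarch T)) (natr_neq0 T) // ldeg_gt0.
Qed.

Definition S_radius n : R :=
  (lq T n)%:R `^ ((ldiff T n)%:~R / (ldeg T n)%:R) * N (ldeg T n)%:R.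

Definition sub_radius n : R :=
  (lq T n)%:R `^ ((ldiff T n)%:~R / (ldeg T n)%:R - n.+1%:R / (linert T n)%:R)
  * N (ldeg T n)%:R.

Lemma S_radius_gt0 n : 0 < S_radius n.
Proof. by rewrite mulr_gt0 ?ldeg_tnorm_gt0 // powR_gt0 // lqR_gt0. Qed.

Lemma sub_radius_gt0 n : 0 < sub_radius n.
Proof. by rewrite mulr_gt0 ?ldeg_tnorm_gt0 // powR_gt0 // lqR_gt0. Qed.

Lemma compactSE : compactS (T := T) = \bigcap_n ball_at n (S_radius n).
Proof. by apply/seteqP; split=> [x xS n _|x xS n]; [exact: xS|exact: xS]. Qed.

Lemma subSE n : subS n.+1 = compactS (T := T) `&` ball_at n (sub_radius n).
Proof. by []. Qed.

Lemma ball_at_measurable n r : 0 < r -> measurable (ball_at n r : set Kborel).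
Proof.
move=> r0; apply: open_Kborel; apply: (Kbar_open_cst r0); exact: ball_at_cst.
Qed.

Lemma compactS_measurable : measurable (compactS (T := T) : set Kborel).
Proof.
rewrite compactSE; apply: bigcapT_measurable => n.
exact: ball_at_measurable (S_radius_gt0 n).
Qed.

Lemma subS_measurable n : measurable (subS n : set Kborel).
Proof.
case: n => [|n]; first exact: compactS_measurable.
rewrite subSE; apply: measurableI; first exact: compactS_measurable.
exact: ball_at_measurable (sub_radius_gt0 n).
Qed.

Lemma subS_sub n (x y : Kbar) : subS n x -> subS n y -> subS n (x - y).
Proof.
have S x' y' : compactS x' -> compactS y' -> compactS (x' - y' : Kbar).
  by move=> xS yS k; exact: ball_at_sub (xS k) (yS k).
case: n => [|n]; first exact: S.
by move=> [xS xb] [yS yb]; split; [exact: S|exact: ball_at_sub xb yb].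
Qed.

Lemma subS_add n (x y : Kbar) : subS n x -> subS n y -> subS n (x + y).
Proof.
have S x' y' : compactS x' -> compactS y' -> compactS (x' + y' : Kbar).
  by move=> xS yS k; exact: ball_at_add (xS k) (yS k).
case: n => [|n]; first exact: S.
by move=> [xS xb] [yS yb]; split; [exact: S|exact: ball_at_add xb yb].
Qed.

Lemma subS0 n : subS n (0 : Kbar).
Proof.
have S : compactS (0 : Kbar).
  move=> k; have -> : (0 : Kbar) k = 0 by [].
  by rewrite (uabs0 (tnorm_nonarch T)) ltW // S_radius_gt0.
case: n => [//|n]; split; first exact: S.
change (N 0 <= sub_radius n).
by rewrite (uabs0 (tnorm_nonarch T)) ltW // sub_radius_gt0.
Qed.

(* On S, the constraint defining S_{n+1} reads |x_n / m|_n <= q^(d - depth):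
   rounding is harmless because |.|_n takes values in q^Z. *)
Definition depth (n : nat) : nat :=
  `|Num.ceil (n.+1%:R * (ldeg T n)%:R / (linert T n)%:R : R)|%N.

Lemma depthE n : (depth n)%:Z = Num.ceil (n.+1%:R * (ldeg T n)%:R / (linert T n)%:R : R).
Proof. by rewrite gez0_abs // ceil_ge0 (lt_le_trans (ltrN10 R)) // divr_ge0 // mulr_ge0. Qed.

Lemma depth_gt n : (n < depth n)%N.
Proof.
have /andP[f0 fm] := linert_bounds T n.
rewrite -ltz_nat depthE ceil_gt_int ltr_pdivlMr ?ltr0n //.
apply: (@lt_le_trans _ _ (n.+1%:R * (linert T n)%:R)).
  by rewrite ltr_pM2r ?ltr0n // ltr_nat.
by rewrite ler_pM2l ?ltr0n // ler_nat.
Qed.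

(** Division by [m] absorbs the factor [N m] of the radii: on [S] the rescaled components [x n / m]
    lie in the inverse different. *)
Lemma tnorm_le_powR n y (r : R) :
  (N y <= (lq T n)%:R `^ (r / (ldeg T n)%:R) * N (ldeg T n)%:R) =
  (nabs T n (y / (ldeg T n)%:R) <= (lq T n)%:R `^ r).
Proof.
have na := tnorm_nonarch T; have m0 := ldeg_gt0 T n.
rewrite -ler_pdivrMr ?ldeg_tnorm_gt0 // -(uabsV na) -(uabsM na) /nabs.
rewrite -[LHS](@ler_pXn2r _ (ldeg T n)) ?nnegrE ?powR_ge0 ?(uabs_ge0 na) //.
congr (_ <= _); rewrite -powR_mulrn ?powR_ge0 // -powRrM divfK //.
by rewrite pnatr_eq0 -lt0n.
Qed.

Lemma compactS_nabs (x : Kbar) n : compactS x ->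
  nabs T n (x n / (ldeg T n)%:R) <= (lq T n)%:R ^ ldiff T n.
Proof.
move=> /(_ n); rewrite tnorm_le_powR powR_intmul //.
Qed.

Lemma div_ldeg_mem (x : Kbar) n : x n / (ldeg T n)%:R \in L n.
Proof. by rewrite rpred_div ?Kbar_mem // rpred_nat. Qed.

Lemma subS_nabs (x : Kbar) n : compactS x -> subS n.+1 x <->
  nabs T n (x n / (ldeg T n)%:R) <= (lq T n)%:R ^ (ldiff T n - (depth n)%:Z).
Proof.
move=> xS; have Q1 := lqR_gt1 T n; have m0 := ldeg_gt0 T n.
set z := x n / _.
have -> : subS n.+1 x <-> nabs T n z <= (lq T n)%:R `^
    ((ldiff T n)%:~R - n.+1%:R * (ldeg T n)%:R / (linert T n)%:R).
  rewrite -tnorm_le_powR mulrBl; set u := (_ / _ / _ : R).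
  have -> : u = n.+1%:R / (linert T n)%:R.
    by rewrite /u mulrAC mulfK // pnatr_eq0 -lt0n.
  by split=> [[] //|].
have [z0|z0] := eqVneq z 0.
  rewrite z0 (uabs0 (nabs_nonarch T n)).
  by split=> _; rewrite ?powR_ge0 // exprz_ge0.
have [w ->] := nabs_value (div_ldeg_mem x n) z0.
rewrite -{1}powR_intmul // depthE.
set s := (_ / _ : R); set e := Num.ceil s.
have le_powR (b c : R) : ((lq T n)%:R `^ b <= (lq T n)%:R `^ c) = (b <= c).
  apply/idP/idP => [|bc]; last by apply: ler_powR => //; exact: ltW.
  apply: contraTT; rewrite -!ltNge => cb.
  by rewrite /powR gt_eqF ?lqR_gt0 // ltr_expR ltr_pM2r // ln_gt0.
rewrite le_powR ler_eXz2l // lerBrDr -lerBrDl -[X in _ - X]/(w%:~R) -intrB.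
rewrite -ceil_le_int -/e; split; lia.
Qed.

(** The factor [1 / m] lies in [layer T 0] and moves inside the trace. For [n = 0], [tower_map] is
    the identity, which agrees with the trace in degree 1. *)
Lemma pairingE n xi (x : Kbar) : xi \in L n ->
  pairing n xi x = ext_trace (L 0) (L n) (xi * (x n / (ldeg T n)%:R)).
Proof.
move=> xin; have xn := Kbar_mem x n; rewrite /pairing /tower_map leqn0.
have fin := tower_finite T n; have sub : {subset L 0 <= L n} by move=> y; exact: layer0_sub.
case: eqP => [n0|_].
  move: xin xn fin sub; rewrite n0 ldeg0 divr1 => xin xn fin sub.
  by rewrite (ext_trace_base fin) ?rpredM // -/(ldeg T 0) ldeg0.
have rF : (ldeg T 0)%:R / (ldeg T n)%:R \in L 0 by rewrite rpred_div ?rpred_nat.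
rewrite -(ext_traceZ fin sub rF) ?rpredM //.
by rewrite ldeg0 div1r mulrCA [_^-1 * _]mulrC.
Qed.

Lemma pairingD n xi eta (x : Kbar) : xi \in L n -> eta \in L n ->
  pairing n (xi + eta) x = pairing n xi x + pairing n eta x.
Proof.
move=> xin etan; have xn := div_ldeg_mem x n.
by rewrite !pairingE ?rpredD // mulrDl ext_traceD ?rpredM ?Kbar_mem ?rpredV ?rpred_nat.
Qed.

Lemma pairing_mem n xi (x : Kbar) : xi \in L n -> pairing n xi x \in L 0.
Proof. by move=> xin; rewrite pairingE // ltr_trace_mem // rpredM // div_ldeg_mem. Qed.

End KbarTopology.

(** * Characters and the return law *)

Lemma Re_sum (R : rcfType) (I : Type) (s : seq I) (f : I -> R[i]) :
  complex.Re (\sum_(i <- s) f i) = \sum_(i <- s) complex.Re (f i).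
Proof. by apply: (big_morph (@complex.Re R)) => // -[a b] [c d]. Qed.

Section Characters.
Variables (R : realType) (K : fieldType) (T : local_tower R K) (chi : K -> R[i]).
Hypothesis chiP : rank_zero_character T chi.
Local Notation N := (tnorm T).
Local Notation L := (layer T).
Local Notation Kbar := (Kbar T).
Local Notation Kborel := (Kborel T).

Implicit Types x y : Kbar.

Definition echar n xi (x : Kbar) : R[i] := chi (pairing n xi x).

Lemma echarD n xi eta x : xi \in L n -> eta \in L n ->
  echar n (xi + eta) x = echar n xi x * echar n eta x.
Proof.
by move=> xin etan; rewrite /echar pairingD // (rzc_add chiP) ?pairing_mem.
Qed.

Lemma echar_trivial n xi x : xi \in L n ->
  nabs T n (xi * (x n / (ldeg T n)%:R)) <= (lq T n)%:R ^ ldiff T n ->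
  echar n xi x = 1.
Proof.
move=> xin xix; apply: (rzc_trivial chiP); first exact: pairing_mem.
rewrite -tnorm_layer0 ?pairing_mem // pairingE //.
by apply: diff_bound_le xix => //; rewrite rpredM // div_ldeg_mem.
Qed.

(** Hence, on [S], a character depends on [xi] only modulo the integers of [layer T n]. *)
Lemma echar_int n xi x : compactS x -> xi \in L n -> nabs T n xi <= 1 ->
  echar n xi x = 1.
Proof.
move=> xS xin xi1; apply: echar_trivial => //.
have na := nabs_nonarch T n; rewrite (uabsM na) -[leRHS]mul1r.
by rewrite ler_pM ?(uabs_ge0 na) // compactS_nabs.
Qed.

(** One half of the duality: the radii [q^D] and [q^(d-D)] multiply to [q^d], where traces are
    integral. *)
Lemma echar_subS n xi x : subS n.+1 x -> xi \in L n ->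
  nabs T n xi <= (lq T n)%:R ^+ depth T n -> echar n xi x = 1.
Proof.
move=> xn xin xi_le; have xS : compactS x by case: xn.
move/(subS_nabs n xS): xn => xn; apply: echar_trivial => //.
have na := nabs_nonarch T n; rewrite (uabsM na).
apply: le_trans (ler_pM _ _ xi_le xn) _; rewrite ?(uabs_ge0 na) //.
rewrite exprnP -expfzDr ?gt_eqF ?lqR_gt0 //.
by rewrite addrC subrK.
Qed.

(** The other half: multiplied by [p] of absolute value [q^D], the rescaled component leaves the
    inverse different, so some integral [v] produces a trace [t] with [N t > 1]. The factor [u / t]
    moves this trace to a point [u] where [chi] is not 1. *)
Lemma echar_nontrivial n x : compactS x -> ~ subS n.+1 x ->
  exists xi, [/\ xi \in L n, nabs T n xi <= (lq T n)%:R ^+ depth T n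
    & echar n xi x <> 1].
Proof.
move=> xS /(contra_not (subS_nabs n xS).2)/negP; rewrite -ltNge => xn.
have na := nabs_nonarch T n; have Q0 := lqR_gt0 T n.
have [p [pn p0 pE]] := nabs_int T n (depth T n)%:Z.
set z := x n / _ in xn.
have zn : z \in L n by exact: div_ldeg_mem.
have [||v [vn v1 trv]] := @diff_bound_sharp _ _ T n (p * z); first by rewrite rpredM.
  rewrite (uabsM na) pE -[ldiff T n](subrK (depth T n)%:Z) addrC.
  by rewrite expfzDr ?gt_eqF // ltr_pM2l ?exprz_gt0.
set t := ext_trace _ _ _ in trv.
have t0 : t \in L 0 by apply: ltr_trace_mem; rewrite rpredM ?vn // rpredM ?pn.
have [u u0 [uq chiu]] := rzc_rank0 chiP.
(* Values on [layer T 0] are powers of its [q], so [N t > 1] means [N t >= q]; this keeps [u / t]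
   integral. *)
have tq : (lq T 0)%:R <= N t.
  rewrite leNgt -nabs0E; apply/negP => h.
  have := @nabs_le _ _ T 0 t 0 t0; rewrite add0r expr0z => /(_ h).
  by rewrite nabs0E leNgt trv.
have tneq : t != 0 by rewrite -(uabs_gt0 (tnorm_nonarch T)); exact: lt_trans trv.
have c0 : u / t \in L 0 by rewrite rpred_div.
have cn : u / t \in L n by exact: layer0_sub.
have c1 : N (u / t) <= 1.
  rewrite (uabsM (tnorm_nonarch T)) (uabsV (tnorm_nonarch T)).
  rewrite ler_pdivrMr ?(uabs_gt0 (tnorm_nonarch T)) // mul1r.
  by apply: le_trans tq; rewrite tnorm_layer0.
have xin : u / t * (v * p) \in L n by apply: rpredM => //; apply: rpredM.
exists (u / t * (v * p)); split=> //.
  rewrite (uabsM na) (uabsM na v) pE exprnP.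
  rewrite mulrA ler_piMl ?exprz_ge0 //.
  by rewrite mulr_ile1 ?(uabs_ge0 na) // exprn_ile1 // (uabs_ge0 (tnorm_nonarch T)).
rewrite /echar pairingE // -/z -mulrA -(mulrA v).
have fin := tower_finite T n; have sub : {subset L 0 <= L n} by move=> y; exact: layer0_sub.
rewrite (ext_traceZ fin sub c0) -/t ?divfK //.
by apply: rpredM => //; apply: rpredM.
Qed.

(** Off the subgroup, translation by a [xi0] with nontrivial character value permutes the ball
    modulo integers and multiplies the sum by that value, so the sum vanishes. *)
Lemma echar_orthogonality n (s : seq K) (x : Kbar) :
  (forall xi, xi \in s -> xi \in L n /\ nabs T n xi <= (lq T n)%:R ^+ depth T n) ->
  (forall xi, xi \in L n -> nabs T n xi <= (lq T n)%:R ^+ depth T n ->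
     exists2 eta, eta \in s & nabs T n (xi - eta) <= 1) ->
  uniq s -> {in s &, forall xi eta, nabs T n (xi - eta) <= 1 -> xi = eta} ->
  compactS x ->
  \sum_(xi <- s) complex.Re (echar n xi x) = (size s)%:R * \1_(subS n.+1) x.
Proof.
move=> sF scov suniq ssep xS; rewrite -Re_sum; have na := nabs_nonarch T n.
have [xn|xn] := pselect (subS n.+1 x).
  rewrite indicE mem_set // mulr1 Re_sum big_seq.
  under eq_bigr => xi xis do rewrite echar_subS ?(sF _ xis).1 ?(sF _ xis).2 //=.
  by rewrite -big_seq big_const_seq iter_addr_0 count_predT.
rewrite indicE memNset // mulr0.
have [xi0 [xi0n xi0_le chi0]] := echar_nontrivial xS xn.
have H xi : exists eta, xi \in s -> eta \in s /\ nabs T n (xi + xi0 - eta) <= 1.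
  have [xis|//] := boolP (xi \in s); last by exists 0.
  have [xin xi_le] := sF _ xis.
  have [||eta es h] := scov (xi + xi0); first by rewrite rpredD.
    exact: uabsD_le.
  by exists eta.
(* [sg xi] represents [xi + xi0]; the integral discrepancy is invisible on [S] by [echar_int]. *)
have [sg sgP] := choice H.
have sg_inj : {in s &, injective sg}.
  move=> a b as_ bs ab; have [_ ha] := sgP a as_; have [_ hb] := sgP b bs.
  apply: ssep => //.
  rewrite (_ : a - b = (a + xi0 - sg a) - (b + xi0 - sg b)); last by rewrite ab; ring.
  exact: uabsB_le.
have perm : perm_eq s (map sg s).
  rewrite perm_sym; apply: uniq_perm => //; first by rewrite map_inj_in_uniq.
  have sub : {subset map sg s <= s} by move=> _ /mapP[a as_ ->]; exact: (sgP a as_).1.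
  have [] := uniq_min_size (_ : uniq (map sg s)) sub _ => //.
  - by rewrite map_inj_in_uniq.
  - by rewrite size_map.
have e : \sum_(xi <- s) echar n xi x = (\sum_(xi <- s) echar n xi x) * echar n xi0 x.
  rewrite {1}(perm_big _ perm) big_map mulr_suml !big_seq; apply: eq_bigr => xi xis.
  have [xin _] := sF _ xis; have [ss sle] := sgP xi xis; have [sn _] := sF _ ss.
  rewrite -echarD // -(subrK (sg xi) (xi + xi0)) echarD // ?rpredB ?rpredD //.
  by rewrite (@echar_int n (_ - _)) ?mul1r ?rpredB ?rpredD.
have /eqP : (\sum_(xi <- s) echar n xi x) * (echar n xi0 x - 1) = 0.
  by rewrite mulrBr mulr1 -e subrr.
by rewrite mulf_eq0 subr_eq0 => /orP[/eqP -> //|/eqP].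
Qed.

Lemma echar_locally_constant n xi : xi \in L n ->
  exists2 r : R, 0 < r & forall x y : Kbar, N (x n - y n) < r -> echar n xi x = echar n xi y.
Proof.
move=> xin; have na := nabs_nonarch T n; have Q0 := lqR_gt0 T n.
set c := 1 + nabs T n (xi / (ldeg T n)%:R).
have c0 : 0 < c by rewrite ltr_wpDr // (uabs_ge0 na).
(* The bound 1 allows replacing the [m]-th power of the norm by the norm itself; the other bound
   sends [xi] times the rescaled difference into the inverse different. *)
exists (Num.min 1 ((lq T n)%:R ^ ldiff T n / c)) => [|x y].
  by rewrite lt_min ltr01 divr_gt0 // exprz_gt0.
rewrite lt_min => /andP[xy1 xyd].
have xyN : N (x n - y n) ^+ ldeg T n <= N (x n - y n).
  rewrite -[leRHS]expr1 ler_wiXn2l ?ldeg_gt0 ?(uabs_ge0 (tnorm_nonarch T)) //.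
  exact: ltW.
rewrite /echar -(subrK y x) -[in LHS](addrC y) /echar.
have xinN : forall z : Kbar, xi * (z n / (ldeg T n)%:R) \in L n.
  by move=> z; rewrite rpredM ?div_ldeg_mem.
have -> : pairing n xi (y + (x - y)) = pairing n xi y + pairing n xi (x - y).
  rewrite !pairingE // -ext_traceD //; congr ext_trace.
  by rewrite -mulrDr -mulrDl.
rewrite (rzc_add chiP) ?pairing_mem // -[RHS]mulr1; congr (_ * _).
apply: echar_trivial => //; rewrite mulrCA (uabsM na).
apply: (@le_trans _ _ (((lq T n)%:R ^ ldiff T n / c) * c)); last by rewrite divfK // gt_eqF.
apply: ler_pM; rewrite ?(uabs_ge0 na) //; last by rewrite /c lerDr.
by apply: le_trans xyN _; exact: ltW.
Qed.

Lemma echar_measurable n xi : xi \in L n ->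
  measurable_fun setT (fun x : Kborel => complex.Re (echar n xi x)).
Proof.
move=> xin _ B mB; rewrite setTI; apply: open_Kborel.
have [r r0 rP] := echar_locally_constant xin.
apply: (@Kbar_open_cst _ _ _ n r) => // x y yx.
by rewrite /preimage /= (rP y x).
Qed.

Lemma echar_Re_le1 n xi x : xi \in L n -> `|complex.Re (echar n xi x)| <= 1.
Proof.
move=> xin; have := normc_ge_Re (echar n xi x).
by rewrite (rzc_unitary chiP) ?pairing_mem // lecR.
Qed.

End Characters.

(** [q^i - q^(i-1)] counts the classes modulo integers of absolute value [q^i]. With
    [v = q^(alpha/m)], the exponent of the process at such a class is [v^i]. *)
Definition ball_law (R : realType) (q v : R) (D : nat) (t : R) : R :=
  q ^- D * (1 + \sum_(1 <= i < D.+1) (q ^+ i - q ^+ i.-1) * expR (- t * v ^+ i)).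

Section Fourier.
Variables (R : realType) (K : fieldType) (T : local_tower R K) (chi : K -> R[i]).
Variables (alpha : R) (mu : R -> probability (Kborel T) R).
Hypothesis chiP : rank_zero_character T chi.
Hypothesis muP : stable_semigroup chi alpha mu.
Local Notation N := (tnorm T).
Local Notation L := (layer T).

Definition rate n : R := (lq T n)%:R `^ (alpha / (ldeg T n)%:R).

(** Integrate [echar_orthogonality] over the transversal: the Fourier transforms are radial in [xi],
    and the other side is [q^D] times the wanted mass. *)
Lemma stable_subS n t : 0 < t ->
  mu t (subS n.+1) = (ball_law (lq T n)%:R (rate n) (depth T n) t)%:E.
Proof.
move=> t0; have na := nabs_nonarch T n; have Q1 := lqR_gt1 T n; have Q0 := lqR_gt0 T n.
have [s [sF scov suniq ssep ssum]] := ball_transversal na (nabs_local T n) (depth T n).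
rewrite -lqE in sF scov ssum.
pose g xi : R := if 1 < N xi then expR (- t * N xi `^ alpha) else 1.
have mS := @compactS_measurable R K T.
have intg xi : xi \in L n ->
    (mu t).-integrable setT (EFin \o (fun x : Kborel T => complex.Re (echar chi n xi x))).
  move=> xin; apply: measurable_bounded_integrable => //.
  - by rewrite (le_lt_trans (probability_le1 _ _)) // ltry.
  - exact: echar_measurable.
  - exists 1; split=> // M M1 x _ /=; apply: le_trans (ltW M1); exact: echar_Re_le1.
have fou xi : xi \in L n ->
    (\int[mu t]_x (complex.Re (echar chi n xi x))%:E)%E = (g xi)%:E.
  move=> xin; have := congr1 (@complex.Re R) (ssg_fourier muP t0 xin).
  rewrite /Cintegral /= /Rintegral => e.
  rewrite -[LHS]fineK; last exact: integrable_fin_num (intg xi xin).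
  by congr EFin; rewrite e /g; case: ifP.
have sumg : \sum_(xi <- s) g xi = 1 + \sum_(1 <= i < (depth T n).+1)
    ((lq T n)%:R ^+ i - (lq T n)%:R ^+ i.-1) * expR (- t * rate n ^+ i).
  rewrite (ssum g (fun i => if i is 0%N then 1 else expR (- t * rate n ^+ i))).
  - by congr (_ + _); rewrite !big_add1 /=; apply: eq_bigr.
  - move=> x; rewrite /nabs /g => x1; case: ltP => // x_gt1.
    by move: x1; rewrite leNgt exprn_egt1 // -lt0n ldeg_gt0.
  - move=> x [//|i] _ xi; rewrite /g /rate.
    have x0 := uabs_ge0 (tnorm_nonarch T) x.
    have -> : 1 < N x.
      rewrite ltNge; apply/negP => x1.
      have : nabs T n x <= 1 by rewrite exprn_ile1.
      by rewrite xi leNgt exprn_egt1.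
    congr (expR (_ * _)); rewrite -[RHS]powR_mulrn ?powR_ge0 // -powRrM.
    rewrite [_ * i.+1%:R]mulrC powRrM powR_mulrn; last exact: ltW.
    rewrite -xi /nabs -powR_mulrn // -powRrM; congr (_ `^ _).
    by rewrite mulrC divfK // pnatr_eq0 -lt0n ldeg_gt0.
have szs : (size s)%:R = (lq T n)%:R ^+ depth T n :> R.
  have := ssum (fun=> 1) (fun=> 1) (fun _ _ => erefl) (fun _ _ _ _ => erefl).
  rewrite big_const_seq iter_addr_0 count_predT => ->.
  under eq_bigr do rewrite mulr1.
  by rewrite (@telescope_sumr_eq _ _ _ (fun i => (lq T n)%:R ^+ i.-1)) //= expr0 addrC subrK.
pose f (i : 'I_(size s)) (x : Kborel T) :=
  (complex.Re (echar chi n (tnth (in_tuple s) i) x))%:E.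
have fL i : tnth (in_tuple s) i \in L n.
  by have /sF[] : tnth (in_tuple s) i \in s by exact: mem_tnth.
have intf i : (mu t).-integrable setT (f i) by exact: intg.
pose C : set (Kborel T) := ~` (compactS (T := T) : set (Kborel T)).
have S0 : mu t C = 0%E.
  by rewrite /C probability_setC // (ssg_supp muP) // subee.
have sumE (x : Kborel T) : compactS (x : Kbar T) ->
    (\sum_i f i x)%E = ((lq T n)%:R ^+ depth T n * \1_(subS n.+1) (x : Kbar T))%:E.
  move=> xS; rewrite -szs -(echar_orthogonality chiP sF scov suniq ssep xS).
  by rewrite [in RHS]big_tnth /f sumEFin.
have : (\int[mu t]_x (\sum_i f i x))%E =
    (((lq T n)%:R ^+ depth T n)%:E * mu t (subS n.+1))%E.
  (* Orthogonality is known only on [S], so its complement, a null set, is discarded. *)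
  rewrite (@negligible_integral _ _ _ _ _ C) //; last 2 first.
  - exact: measurableC.
  - exact: integrable_sum.
  rewrite setTD /C setCK.
  under eq_integral => x /set_mem xS do rewrite sumE // EFinM.
  rewrite integralZl //; last first.
    apply: (@measurable_bounded_integrable _ _ _ _ (\1_(subS n.+1) : Kborel T -> R)) => //.
    - by rewrite (le_lt_trans (probability_le1 _ _)) // ltry.
    - by apply: measurable_realfun.measurable_indic; exact: subS_measurable.
    - exists 1; split=> // M M1 x _ /=; apply: le_trans (ltW M1).
      by rewrite indicE normr_nat lern1 leq_b1.
  by rewrite integral_indic //; [rewrite setIidl // => x []|exact: subS_measurable].
rewrite integral_sum //; under eq_bigr do rewrite /f fou //.
rewrite sumEFin -(big_tnth _ _ s xpredT g) sumg.
have fin : mu t (subS n.+1) \is a fin_num by exact: fin_num_measure (subS_measurable _).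
rewrite -(fineK fin) -EFinM => -[] e.
by rewrite /ball_law e mulKf // expf_neq0 // gt_eqF.
Qed.

End Fourier.

(** * Estimates of the return law *)

Section BallLaw.
Variables (R : realType) (q v : R) (D : nat).
Hypotheses (q2 : 2 <= q) (v1 : 1 <= v) (vq : v ^+ 4 <= q).
Local Notation F := (ball_law q v D).
(** [F] is the Laplace transform of a probability measure: mass [q^-D] at rate 0 and [w i] at rate
    [v^i]. *)
Let w i := q ^- D * (q ^+ i - q ^+ i.-1).

Let q0 : 0 < q. Proof. exact: lt_le_trans q2. Qed.
Let v0 : 0 < v. Proof. exact: lt_le_trans v1. Qed.

Let ball_lawE t : F t = q ^- D + \sum_(1 <= i < D.+1) w i * expR (- t * v ^+ i).
Proof.
rewrite /ball_law mulrDr mulr1 mulr_sumr; congr (_ + _).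
by apply: eq_bigr => i _; rewrite mulrA.
Qed.

Let w_ge0 i : 0 <= w i.
Proof.
rewrite mulr_ge0 ?invr_ge0 ?exprn_ge0 ?(ltW q0) // subr_ge0.
by case: i => //= i; rewrite ler_weXn2l // (le_trans _ q2) // ler1n.
Qed.

Let sum_w : q ^- D + \sum_(1 <= i < D.+1) w i = 1.
Proof.
rewrite -mulr_sumr (@telescope_sumr_eq _ _ _ (fun i => q ^+ i.-1)) //= expr0.
by rewrite mulrBr mulr1 addrC subrK mulVf // expf_neq0 // gt_eqF.
Qed.

Lemma ball_law0 : F 0 = 1.
Proof.
rewrite ball_lawE -[RHS]sum_w; congr (_ + _); apply: eq_bigr => i _.
by rewrite oppr0 mul0r expR0 mulr1.
Qed.

Lemma ball_law_le t : 0 <= t -> F t <= q ^- D + (1 - q ^- D) * expR (- t).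
Proof.
move=> t0; rewrite ball_lawE lerD2l.
have -> : 1 - q ^- D = \sum_(1 <= i < D.+1) w i by rewrite -sum_w addrAC subrr add0r.
rewrite mulr_suml; apply: ler_sum => i _; rewrite ler_wpM2l // ler_expR.
by rewrite -[leRHS]mulr1 ler_wnM2l ?oppr_le0 // exprn_ege1.
Qed.

Lemma ball_law_ge t : 0 <= t -> 1 - F t <= 1 - expR (- t * v ^+ D).
Proof.
move=> t0; rewrite lerD2l lerN2 ball_lawE -[leLHS]mul1r -[X in X * _]sum_w.
rewrite mulrDl mulr_suml; apply: lerD.
  rewrite ler_piMr ?invr_ge0 ?exprn_ge0 ?(ltW q0) // -expR0 ler_expR.
  by rewrite mulNr oppr_le0 mulr_ge0 // exprn_ge0 // ltW.
rewrite big_nat_cond [leRHS]big_nat_cond; apply: ler_sum => i /andP[/andP[_ iD] _].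
rewrite ler_wpM2l // ler_expR ler_wnM2l ?oppr_le0 //.
by rewrite ler_weXn2l.
Qed.

(* Concavity of [1 - exp (- x)]. *)
Let expR_concave (a b x : R) : 0 < a -> a <= b ->
  a * (1 - expR (- x * b)) <= b * (1 - expR (- x * a)).
Proof.
move=> a0 ab; have b0 := lt_le_trans a0 ab.
have e1 : expR (- x * a) * (1 + x * a) <= 1.
  by rewrite mulNr expRN ler_pdivrMl ?expR_gt0 // mulr1 expR_ge1Dx.
have e2 : expR (- x * a) * (1 - x * (b - a)) <= expR (- x * b).
  have -> : - x * b = - x * a + - (x * (b - a)) by ring.
  by rewrite expRD ler_pM2l ?expR_gt0 // expR_ge1Dx.
have ba : 0 <= b - a by rewrite subr_ge0.
have := lerD (ler_wpM2l ba e1) (ler_wpM2l (ltW a0) e2).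
rewrite !mulrA; lra.
Qed.

Let geometric_le1 (r : R) (J : nat) : 0 <= r -> (1 - r) * \sum_(j < J) r ^+ j <= 1.
Proof.
by move=> r0; rewrite -opprB mulNr -subrX1 opprB gerBl exprn_ge0.
Qed.

(** The arithmetic-geometric inequality [4 v <= v^4 + 3], through the factor [(v - 1)^2]. *)
Let v4 : 4 * v <= q + 3.
Proof.
have : 0 <= (v - 1) ^+ 2 * (v ^+ 2 + 2 * v + 3).
  by rewrite mulr_ge0 ?sqr_ge0 // !addr_ge0 ?sqr_ge0 // mulr_ge0 // ltW.
rewrite (_ : _ * _ = v ^+ 4 - 4 * v + 3); last by ring.
move=> h; have vq' : 0 <= q - v ^+ 4 by rewrite subr_ge0.
rewrite -subr_ge0; have -> : q + 3 - 4 * v = (q - v ^+ 4) + (v ^+ 4 - 4 * v + 3) by ring.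
exact: addr_ge0.
Qed.

(** By [v4], [v / q <= 1/4 + 3/(4 q)], which is at most 5/8 for [q >= 2]. *)
Lemma rate_decay : q ^- D * v ^+ D <= (5 / 8) ^+ D.
Proof.
rewrite mulrC -exprVn -exprMn; apply: lerXn2r; rewrite ?nnegrE ?divr_ge0 ?(ltW v0) ?(ltW q0) //.
by rewrite ler_pdivrMr //; have := (v4, q2) => -[]; lra.
Qed.

Lemma weight_decay : q ^- D <= (5 / 8) ^+ D.
Proof.
apply: le_trans rate_decay; rewrite ler_peMr ?invr_ge0 ?exprn_ge0 ?(ltW q0) //.
exact: exprn_ege1.
Qed.

(** With [j = D - i] the weights are [(1 - 1/q) q^-j], giving a geometric series of ratio [v / q];
    the constant 4/3 is [v4] rearranged as [q - 1 <= 4/3 (q - v)]. *)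
Let weight_sum : \sum_(1 <= i < D.+1) w i * v ^+ (D - i) <= 4 / 3.
Proof.
have -> : \sum_(1 <= i < D.+1) w i * v ^+ (D - i) =
    (1 - q^-1) * \sum_(j < D) (v / q) ^+ j.
  rewrite big_add1 /= big_mkord (reindex_inj rev_ord_inj) /= mulr_sumr.
  apply: eq_bigr => j _; have jD := ltn_ord j.
  rewrite subnSK // (subKn (ltnW jD)) /w.
  have qn0 : q ^+ (D - j) != 0 by rewrite expf_neq0 // gt_eqF.
  have -> : q ^+ (D - j).-1 = q ^+ (D - j) / q.
    by rewrite -{2}(prednK (n := D - j)) ?subn_gt0 // exprSr mulfK // gt_eqF.
  have -> : q ^- D = q ^- j / q ^+ (D - j).
    by rewrite -invfM -exprD subnKC // ltnW.
  rewrite exprMn exprVn; have qj0 : q ^+ j != 0 by rewrite expf_neq0 // gt_eqF.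
  by field; rewrite qn0 qj0 gt_eqF.
apply: (@le_trans _ _ (4 / 3 * ((1 - v / q) * \sum_(j < D) (v / q) ^+ j))).
  rewrite mulrA ler_wpM2r ?sumr_ge0 // => [j _|]; first by rewrite exprn_ge0 // divr_ge0 // ltW.
  rewrite -(ler_pM2r q0); have qn0 : q != 0 by rewrite gt_eqF.
  have -> : (1 - q^-1) * q = q - 1 by field.
  have -> : 4 / 3 * (1 - v / q) * q = 4 / 3 * (q - v) by field.
  by have := (v4, q2) => -[]; lra.
by rewrite -[leRHS]mulr1 ler_wpM2l // geometric_le1 // divr_ge0 // ltW.
Qed.

(** The rates [v^i] contribute at most [w i * v^(D-i)] each, independently of [h] and [J]. Only the
    constant part [q^-D] of [F] grows with the horizon [J h]. *)
Lemma ball_law_renewal (h : R) (J : nat) : 0 <= h ->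
  (1 - F h) * \sum_(j < J) F (j%:R * h) <= 4 / 3 + J%:R * h * (q ^- D * v ^+ D).
Proof.
move=> h0; set E := 1 - expR (- h * v ^+ D).
have E0 : 0 <= E.
  by rewrite subr_ge0 -expR0 ler_expR mulNr oppr_le0 mulr_ge0 // exprn_ge0 // ltW.
have F0 t : 0 <= F t.
  rewrite ball_lawE addr_ge0 ?invr_ge0 ?exprn_ge0 ?(ltW q0) //.
  by apply: sumr_ge0 => i _; rewrite mulr_ge0 // ltW // expR_gt0.
apply: (@le_trans _ _ (E * \sum_(j < J) F (j%:R * h))).
  by rewrite ler_wpM2r ?sumr_ge0 // ball_law_ge.
have -> : \sum_(j < J) F (j%:R * h) = J%:R * q ^- D +
    \sum_(1 <= i < D.+1) w i * \sum_(j < J) expR (- h * v ^+ i) ^+ j.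
  under eq_bigr do rewrite ball_lawE.
  rewrite big_split /= sumr_const card_ord mulr_natl; congr (_ + _).
  rewrite exchange_big /=; apply: eq_bigr => i _; rewrite mulr_sumr.
  apply: eq_bigr => j _; rewrite -expRM_natl; congr (_ * expR _); ring.
rewrite mulrDr addrC; apply: lerD.
  apply: le_trans weight_sum; rewrite mulr_sumr.
  rewrite big_nat_cond [leRHS]big_nat_cond; apply: ler_sum => i /andP[/andP[_ iD] _].
  rewrite mulrCA ler_wpM2l //; set r := expR _.
  have vi0 : 0 < v ^+ i by rewrite exprn_gt0.
  (* Scaling by [v^i] brings the claim to the form of [expR_concave] between the rates [v^i] and
     [v^D]. *)
  rewrite -(ler_pM2l vi0) -exprD subnKC // mulrA.
  apply: (@le_trans _ _ (v ^+ D * (1 - r) * \sum_(j < J) r ^+ j)).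
    rewrite ler_wpM2r ?sumr_ge0 // => [j _|]; first by rewrite exprn_ge0 // expR_ge0.
    by apply: expR_concave; rewrite // ler_weXn2l.
  rewrite -mulrA -[leRHS]mulr1 ler_wpM2l ?exprn_ge0 ?(ltW v0) // geometric_le1 //.
  exact: expR_ge0.
have Eh : E <= h * v ^+ D.
  by rewrite /E lerBlDr -lerBlDl -mulNr expR_ge1Dx.
rewrite (_ : J%:R * h * _ = h * v ^+ D * (J%:R * q ^- D)); last by ring.
by rewrite ler_wpM2r // mulr_ge0 // invr_ge0 exprn_ge0 // ltW.
Qed.

End BallLaw.

(** * Returns of the process *)

(** The threshold [k0] allows two intervals to be served by one common grid level. *)
Lemma dyadic_between (R : realType) (s t : R) : 0 <= s -> s < t ->
  exists k0 : nat, forall k, (k0 <= k)%N -> exists i : nat, s < i%:R / 2 ^+ k < t.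
Proof.
move=> s0 st; have ts0 : 0 < t - s by rewrite subr_gt0.
have [k0 k0P] := natpow_unbounded (q := 2) (t - s)^-1 isT.
exists k0 => k k0k; have p0 : 0 < 2 ^+ k :> R by rewrite exprn_gt0.
have kP : (2 ^+ k)^-1 < t - s.
  rewrite invf_plt ?posrE //; apply: lt_le_trans k0P _.
  by rewrite ler_weXn2l // ler1n.
exists (Num.truncn (s * 2 ^+ k)).+1.
have s2 : 0 <= s * 2 ^+ k by rewrite mulr_ge0 // ltW.
rewrite ltr_pdivlMr // truncnS_gt /= ltr_pdivrMr //.
rewrite -natr1; apply: le_lt_trans (_ : s * 2 ^+ k + 1 < _).
  by rewrite lerD2r truncn_le.
by rewrite -[X in _ + X](mulVf (lt0r_neq0 p0)) -mulrDl ltr_pM2r // -ltrBrDl.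
Qed.

Section Process.
Variables (R : realType) (K : fieldType) (T : local_tower R K).
Variables (mu : R -> probability (Kborel T) R).
Variables (d : measure_display) (Om : measurableType d) (P : probability Om R).
Variables (X : R -> Om -> Kbar T).
Hypothesis XP : levy_process mu P X.
Local Notation inS n t w := (subS n (X t w)).
Local Notation dy k i := (i%:R / 2 ^+ k : R).

Lemma dyadic_ge0 k i : 0 <= dy k i.
Proof. by rewrite divr_ge0 // exprn_ge0. Qed.

(** Within [S], membership in [S_n] is a locally constant condition, so right continuity freezes it
    on an interval to the right of [t]. *)
Lemma path_right n t w : 0 <= t -> exists2 e : R, 0 < e &
  forall s, t <= s -> s < t + e -> (inS n s w <-> inS n t w).
Proof.
move=> t0; case: n => [|n].
  exists 1 => // s ts _; split=> _; apply: (levy_S XP) => //.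
  exact: le_trans ts.
have na := tnorm_nonarch T.
pose U := [set y : Kbar T | tnorm T (y n - X t w n) < sub_radius T n].
have Uo : open U.
  apply: (@Kbar_open_cst _ _ _ n (sub_radius T n)); first exact: sub_radius_gt0.
  move=> x y yx Ux; rewrite /U /= -(subrK (x n) (y n)) -addrA.
  exact: (uabsD_lt na).
have UX : nbhs (X t w) U.
  by apply: open_nbhs_nbhs; split=> //; rewrite /U /= subrr (uabs0 na) sub_radius_gt0.
have := levy_right XP t0 UX.
rewrite /= /at_right => -[e /= e0 eP]; exists e => // s.
rewrite le_eqVlt => /orP[/eqP -> //|ts] se.
have Us : U (X s w).
  by apply: (eP s) => //=; rewrite distrC gtr0_norm ?subr_gt0 // ltrBlDl.
have sS : compactS (X s w) by apply: (levy_S XP); apply: ltW; exact: le_lt_trans ts.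
have tS : compactS (X t w) by apply: (levy_S XP).
split=> -[_ b]; split=> //; apply: ball_at_cst b => //.
by rewrite (uabs_distC na).
Qed.

Lemma exit_time_ge0 n w : (0 <= exit_time X n w)%E.
Proof. by apply: le_ereal_inf_tmp => _ [t [t0 _] <-]; rewrite lee_fin. Qed.

(** If the path were inside at all times before [t], it would stay inside slightly beyond [t] by
    [path_right], and the exit time would exceed [t]. *)
Lemma exit_before n w t : (exit_time X n w <= t%:E)%E -> inS n t w ->
  exists s, [/\ 0 <= s, s < t & ~ inS n s w].
Proof.
move=> et tS; have t0 : 0 <= t by rewrite -lee_fin (le_trans (exit_time_ge0 n w)).
apply: contrapT => /forallNP nex.
have [e e0 eP] := path_right n w t0.
have : ((t + e)%:E <= exit_time X n w)%E.
  apply: le_ereal_inf_tmp => _ [s [s0 sS] <-]; rewrite lee_fin leNgt.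
  apply/negP => st; have [ts|st'] := leP t s.
    by apply: sS; apply/eP.
  by apply: (nex s).
move=> /le_trans/(_ et); rewrite lee_fin -{2}[t]addr0 lerD2l leNgt.
by rewrite e0.
Qed.

Lemma exit_after n w s t : 0 <= s -> s <= t -> (t%:E < exit_time X n w)%E -> inS n s w.
Proof.
move=> s0 st te; apply: contrapT => nS.
have : (exit_time X n w <= s%:E)%E by apply: ereal_inf_lbound; exists s.
by move=> /(lt_le_trans te); rewrite lte_fin ltNge st.
Qed.

(** Any time outside starts an interval outside, which contains a dyadic time; beyond [t],
    [path_right] at [t] itself takes over. *)
Lemma exit_gt_dyadic n w t : 0 <= t -> inS n t w ->
  (forall k i, dy k i <= t -> inS n (dy k i) w) -> (t%:E < exit_time X n w)%E.
Proof.
move=> t0 tS dS; have [e e0 eP] := path_right n w t0.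
apply: (@lt_le_trans _ _ (t + e)%:E); first by rewrite lte_fin ltrDl.
apply: le_ereal_inf_tmp => _ [s [s0 sS] <-]; rewrite lee_fin leNgt.
apply/negP => ste; have [ts|st] := leP t s.
  by apply: sS; apply/eP.
have [e' e'0 e'P] := path_right n w s0.
have [|k0 /(_ k0 (leqnn _))[i /andP[si]]] := @dyadic_between R s (Num.min t (s + e')) s0.
  by rewrite lt_min st ltrDl.
rewrite lt_min => /andP[it ie]; apply: sS; apply/(e'P _ (ltW si) ie).
exact: dS (ltW it).
Qed.

Definition return_event n N : set Om :=
  [set w | exists t, (exit_time X n w <= t%:E < exit_time X N w)%E /\ inS n t w].

(** Written with countable operations to obtain measurability: an outside time and a later inside
    time are pushed right to points of one grid. *)
Lemma return_event_dyadic n N : return_event n N =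
  \bigcup_k \bigcup_i \bigcup_(j in [set j | (i < j)%N])
    ([set w | ~ inS n (dy k i) w] `&` [set w | inS n (dy k j) w] `&`
     \bigcap_l \bigcap_(m in [set m | dy l m <= dy k j]) [set w | inS N (dy l m) w]).
Proof.
apply/seteqP; split=> w.
  move=> [t [/andP[et te] tS]].
  have [s [s0 st sS]] := exit_before et tS.
  have t0 : 0 <= t by apply: le_trans s0 (ltW st).
  have [e1 e10 e1P] := path_right n w s0.
  have [e2 e20 e2P] := path_right n w t0.
  have [u tu ue] : exists2 u : R, t < u & (u%:E <= exit_time X N w)%E.
    case: (exit_time X N w) te => [r tr| _|//]; first by exists r => //; rewrite -lte_fin.
    by exists (t + 1); rewrite ?ltrDl // leey.
  have [|k1 k1P] := @dyadic_between R s (Num.min t (s + e1)) s0.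
    by rewrite lt_min st ltrDl.
  have [|k2 k2P] := @dyadic_between R t (Num.min u (t + e2)) t0.
    by rewrite lt_min tu ltrDl.
  have [i /andP[si]] := k1P (maxn k1 k2) (leq_maxl _ _).
  rewrite lt_min => /andP[it ie].
  have [j /andP[tj]] := k2P (maxn k1 k2) (leq_maxr _ _).
  rewrite lt_min => /andP[ju je].
  exists (maxn k1 k2) => //; exists i => //; exists j.
    rewrite /= -(ltr_nat R) -(@ltr_pM2r _ (2 ^+ maxn k1 k2)^-1) ?invr_gt0 ?exprn_gt0 //.
    exact: lt_trans it tj.
  split; first split.
  - by move=> h; apply: sS; apply/(e1P _ (ltW si) ie).
  - by apply/(e2P _ (ltW tj) je).
  - move=> l _ m /= lm; apply: (exit_after (dyadic_ge0 l m) lm).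
    by apply: lt_le_trans ue; rewrite lte_fin.
move=> [k _ [i _ [j /= ij [[iS jS] mS]]]].
exists (dy k j); split=> //; apply/andP; split.
  apply: (@le_trans _ _ (dy k i)%:E).
    by apply: ereal_inf_lbound; exists (dy k i) => //; split=> //; exact: dyadic_ge0.
  by rewrite lee_fin ler_pM2r ?invr_gt0 ?exprn_gt0 // ler_nat ltnW.
apply: exit_gt_dyadic; first exact: dyadic_ge0.
- exact: (mS k I j (lexx _)).
- by move=> l m lm; exact: (mS l I m lm).
Qed.

Lemma inS_measurable n t : 0 <= t -> measurable [set w | inS n t w].
Proof.
move=> t0; have := levy_mfun XP t0 measurableT (subS_measurable n).
by rewrite setTI.
Qed.

Lemma return_event_measurable n N : measurable (return_event n N).
Proof.
rewrite return_event_dyadic; apply: bigcup_measurable => k _.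
apply: bigcup_measurable => i _; apply: bigcup_measurable => j _.
apply: measurableI; first apply: measurableI.
- rewrite (_ : [set w | _] = ~` [set w | inS n (dy k i) w]) //.
  by apply: measurableC; apply: inS_measurable; exact: dyadic_ge0.
- by apply: inS_measurable; exact: dyadic_ge0.
- apply: bigcap_measurableType => l _; apply: bigcap_measurableType => m _.
  by apply: inS_measurable; exact: dyadic_ge0.
Qed.

Lemma Qprob_return n N : Qprob P X n N = (1 - P (return_event n N))%E.
Proof.
rewrite -probability_setC; last exact: return_event_measurable.
congr (P _); apply/seteqP; split=> w h.
  by move=> [t [et tS]]; exact: h et tS.
by move=> t et tS; apply: h; exists t.
Qed.

Definition reentry n (k j : nat) : set Om :=
  [set w | ~ inS n (dy k j) w] `&` [set w | inS n (dy k j.+1) w].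

Definition crossing n (M k : nat) : set Om :=
  \big[setU/set0]_(j < M * 2 ^ k) reentry n k j.

(** A discrete intermediate value argument. Indices that need not be adjacent make the condition
    stable under refinement of the grid. *)
Lemma crossingP n M k w : crossing n M k w <->
  exists i j, [/\ (i < j)%N, (j <= M * 2 ^ k)%N, ~ inS n (dy k i) w & inS n (dy k j) w].
Proof.
rewrite /crossing -(bigcup_mkord _ (reentry n k)); split.
  by move=> [j /= jM [jS jS']]; exists j, j.+1.
move=> [i [j [ij jM iS jS]]].
elim: j ij jM jS => // j IH; rewrite ltnS => ij jM jS.
have [jS'|jS'] := pselect (inS n (dy k j) w); last by exists j.
apply: IH => //; last exact: ltnW.
by move: ij; rewrite leq_eqVlt => /orP[/eqP e|//]; rewrite e in iS.
Qed.

(** An integer time up to [M] outside [S_N] bounds the exit time from [S_N], so the return occurs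
    strictly before [M]. *)
Lemma return_event_sub n N M : return_event n N `<=`
  [set w | forall i, (i <= M)%N -> inS N i%:R w] `|` \bigcup_k crossing n M k.
Proof.
move=> w [t [/andP[et te] tS]].
have [?|/existsNP[i0 /not_implyP[i0M i0S]]] :=
  pselect (forall i, (i <= M)%N -> inS N i%:R w); [by left|right].
have tM : t < M%:R.
  rewrite -lte_fin; apply: lt_le_trans te _.
  apply: (@le_trans _ _ i0%:R%:E); last by rewrite lee_fin ler_nat.
  by apply: ereal_inf_lbound; exists i0%:R.
have [s [s0 st sS]] := exit_before et tS.
have t0 : 0 <= t by apply: le_trans s0 (ltW st).
have [e1 e10 e1P] := path_right n w s0.
have [e2 e20 e2P] := path_right n w t0.
have [|k1 k1P] := @dyadic_between R s (Num.min t (s + e1)) s0.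
  by rewrite lt_min st ltrDl.
have [|k2 k2P] := @dyadic_between R t (Num.min M%:R (t + e2)) t0.
  by rewrite lt_min tM ltrDl.
have [i /andP[si]] := k1P (maxn k1 k2) (leq_maxl _ _).
rewrite lt_min => /andP[it ie].
have [j /andP[tj]] := k2P (maxn k1 k2) (leq_maxr _ _).
rewrite lt_min => /andP[jM je].
exists (maxn k1 k2) => //; apply/crossingP; exists i, j; split.
- rewrite -(ltr_nat R) -(@ltr_pM2r _ (2 ^+ maxn k1 k2)^-1) ?invr_gt0 ?exprn_gt0 //.
  exact: lt_trans it tj.
- by rewrite -(ler_nat R) natrM natrX -ler_pdivrMr ?exprn_gt0 // ltW.
- by move=> h; apply: sS; apply/(e1P _ (ltW si) ie).
- by apply/(e2P _ (ltW tj) je).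
Qed.

Lemma reentry_measurable n k j : measurable (reentry n k j).
Proof.
apply: measurableI; last first.
  by apply: inS_measurable; exact: dyadic_ge0.
rewrite (_ : [set w | _] = ~` [set w | inS n (dy k j) w]) //.
by apply: measurableC; apply: inS_measurable; exact: dyadic_ge0.
Qed.

Lemma crossing_measurable n M k : measurable (crossing n M k).
Proof. by apply: bigsetU_measurable => j _; exact: reentry_measurable. Qed.

Lemma crossing_mono n M : {homo crossing n M : k l / (k <= l)%N >-> (k <= l)%O}.
Proof.
move=> k l kl; apply/subsetPset => w /crossingP[i [j [ij jM iS jS]]].
have dyE m : dy l (m * 2 ^ (l - k))%N = dy k m.
  have p2 a : (2 : R) ^+ a != 0 by rewrite expf_neq0 // pnatr_eq0.
  rewrite natrM natrX (_ : 2 ^+ l = 2 ^+ (l - k) * 2 ^+ k); last by rewrite -exprD subnK.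
  by rewrite invfM mulrA mulfK.
apply/crossingP; exists (i * 2 ^ (l - k))%N, (j * 2 ^ (l - k))%N; split.
- by rewrite ltn_pmul2r // expn_gt0.
- have -> : (2 ^ l = 2 ^ k * 2 ^ (l - k))%N by rewrite -expnD subnKC.
  by rewrite mulnA leq_pmul2r // expn_gt0.
- by rewrite dyE.
- by rewrite dyE.
Qed.

(** Because [S_n] is a subgroup, both positions lie in it exactly when the first position and the
    increment do. *)
Lemma inS_pair n s h : 0 <= s -> 0 <= h ->
  P ([set w | inS n s w] `&` [set w | inS n (s + h) w]) =
  (P [set w | inS n s w] * P [set w | inS n h w])%E.
Proof.
move=> s0 h0; have sh : s <= s + h by rewrite lerDl.
(* The times 0, [s], [s + h], continued constantly to stay nondecreasing; only two increments are
   used. *)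
pose t (i : nat) : R := if i is i'.+1 then (if i' is 0%N then s else s + h) else 0.
have tmono : nondecreasing_seq t.
  by apply/nondecreasing_seqP => -[|[|i]] //=.
have := @levy_indep _ _ _ _ _ _ _ _ XP 2 t (fun=> subS n) (lexx 0) tmono
  (fun=> subS_measurable n).
rewrite !big_ord_recr big_ord0 /= mul1e => indep.
rewrite -(levy_stat XP s0 h0 (subS_measurable n)).
rewrite (_ : [set w | inS n s w] `&` _ = [set w | forall i, (i < 2)%N ->
    subS n (X (t i.+1) w - X (t i) w)]).
  rewrite indep; congr (P _ * _)%E.
  by apply/seteqP; split=> w /=; rewrite (levy_0 XP) subr0.
apply/seteqP; split=> w /=.
  move=> [ws wsh] [|[|//]] _ /=; first by rewrite (levy_0 XP) subr0.
  exact: subS_sub.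
move=> h'; have := h' 0%N isT; rewrite /= (levy_0 XP) subr0 => ws; split=> //.
by rewrite -(subrK (X s w) (X (s + h) w)); apply: subS_add => //; exact: (h' 1%N).
Qed.

Lemma stay_prob n M (p : R) : P [set w | inS n 1 w] = p%:E ->
  P [set w | forall i, (i <= M)%N -> inS n i%:R w] = (p ^+ M)%:E.
Proof.
move=> Pp; have tmono : nondecreasing_seq (fun i : nat => i%:R : R).
  by move=> i j ij; rewrite ler_nat.
have step i : P [set w | subS n (X i.+1%:R w - X i%:R w)] = p%:E.
  have := levy_stat XP (ler0n R i) ler01 (subS_measurable n).
  by rewrite natr1 Pp.
have -> : [set w | forall i, (i <= M)%N -> inS n i%:R w] =
    [set w | forall i, (i < M)%N -> subS n (X i.+1%:R w - X i%:R w)].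
  apply/seteqP; split=> w /= h.
    by move=> i iM; apply: subS_sub; apply: h => //; exact: ltnW.
  elim=> [|i IH] iM; first by rewrite (levy_0 XP); exact: subS0.
  rewrite -(subrK (X i%:R w) (X i.+1%:R w)).
  by apply: subS_add; [exact: h|apply: IH; exact: ltnW].
rewrite (@levy_indep _ _ _ _ _ _ _ _ XP M (fun i : nat => i%:R) (fun=> subS n)
  (lexx 0) tmono (fun=> subS_measurable n)).
under eq_bigr do rewrite step.
rewrite big_const_ord; elim: M => //= M ->.
by rewrite -EFinM exprS.
Qed.

Lemma reentryE n k j (F : R -> R) :
  (forall t, 0 <= t -> P [set w | inS n t w] = (F t)%:E) ->
  P (reentry n k j) =
    (F (j.+1%:R * (2 ^+ k)^-1) - F (j%:R * (2 ^+ k)^-1) * F (2 ^+ k)^-1)%:E.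
Proof.
move=> PF; have h0 : 0 <= (2 ^+ k)^-1 :> R by rewrite invr_ge0 exprn_ge0.
have [mA mB] : measurable [set w | inS n (dy k j) w] /\ measurable [set w | inS n (dy k j.+1) w].
  by split; apply: inS_measurable; exact: dyadic_ge0.
have -> : reentry n k j = [set w | inS n (dy k j.+1) w] `\` [set w | inS n (dy k j) w].
  by rewrite setDE setIC.
rewrite measureD //; last by rewrite (le_lt_trans (probability_le1 _ mB)) // ltry.
rewrite setIC EFinB EFinM.
rewrite -(PF _ (dyadic_ge0 k j.+1)) -(PF _ (dyadic_ge0 k j)) -(PF _ h0).
congr (_ - _)%E; rewrite -(inS_pair _ (dyadic_ge0 k j) h0).
by rewrite -(natr1 j) mulrDl mul1r.
Qed.

Lemma crossing_le n M k (F : R -> R) :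
  (forall t, 0 <= t -> P [set w | inS n t w] = (F t)%:E) -> F 0 = 1 ->
  (P (crossing n M k) <=
    ((1 - F (2 ^+ k)^-1) * (\sum_(j < M * 2 ^ k) F (j%:R * (2 ^+ k)^-1)) + F M%:R - 1)%:E)%E.
Proof.
move=> PF F0; apply: le_trans (Boole_inequality P (fun j _ => reentry_measurable n k j)) _.
rewrite (eq_bigr _ (fun j _ => reentryE k (nat_of_ord j) PF)).
rewrite sumEFin lee_fin sumrB.
set h := (2 ^+ k)^-1.
have -> : F M%:R = F ((M * 2 ^ k)%:R * h).
  by rewrite natrM natrX mulfK // expf_neq0 // pnatr_eq0.
have : \sum_(j < M * 2 ^ k) F (j.+1%:R * h) - \sum_(j < M * 2 ^ k) F (j%:R * h) =
    F ((M * 2 ^ k)%:R * h) - 1.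
  rewrite -sumrB -(big_mkord xpredT (fun j => F (j.+1%:R * h) - F (j%:R * h))).
  by rewrite (telescope_sumr (fun j => F (j%:R * h))) // mul0r F0.
rewrite -mulr_suml; lra.
Qed.

(** The bound [B] is uniform in the level [k]; crossings increase with [k], so continuity from below
    passes it to their union. *)
Lemma return_event_le n N M (p : R) (F : R -> R) (B : R) :
  P [set w | inS N 1 w] = p%:E ->
  (forall t, 0 <= t -> P [set w | inS n t w] = (F t)%:E) -> F 0 = 1 ->
  (forall k, (1 - F (2 ^+ k)^-1) * (\sum_(j < M * 2 ^ k) F (j%:R * (2 ^+ k)^-1)) <= B) ->
  (P (return_event n N) <= (p ^+ M + (B + F M%:R - 1))%:E)%E.
Proof.
move=> Pp PF F0 FB; set stay := [set w | forall i, (i <= M)%N -> inS N i%:R w].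
have mcross : measurable (\bigcup_k crossing n M k).
  by apply: bigcupT_measurable => k; exact: crossing_measurable.
have mstay : measurable stay.
  rewrite (_ : stay = \bigcap_(i in [set i | (i <= M)%N]) [set w | inS N i%:R w]).
    by apply: bigcap_measurableType => i _; exact: inS_measurable.
  by apply/seteqP; split=> w h i; exact: h.
apply: le_trans (le_measure P (mem_set (return_event_measurable n N))
  (mem_set (measurableU _ _ mstay mcross)) (@return_event_sub n N M)) _.
have Pstay : (P stay <= (p ^+ M)%:E)%E by rewrite (stay_prob _ Pp).
have Pcross : (P (\bigcup_k crossing n M k) <= (B + F M%:R - 1)%:E)%E.
  have cvg_cross := @nondecreasing_cvg_mu _ _ _ P _
    (@crossing_measurable n M) mcross (@crossing_mono n M).
  rewrite -(cvg_lim (@ereal_hausdorff R) cvg_cross).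
  apply: lime_le; first exact: cvgP cvg_cross.
  apply: nearW => k; apply: le_trans (crossing_le M k PF F0) _.
  by rewrite lee_fin !lerD2r.
exact: le_trans (measureU2 P mstay mcross) (leeD Pstay Pcross).
Qed.

End Process.

(** * Choice of the horizon and the lower bound for the limit inferior *)

Lemma limn_einf_ge (R : realType) (u : (\bar R)^nat) (c : \bar R) (n0 : nat) :
  (forall n, (n0 <= n)%N -> (c <= u n)%E) -> (c <= limn_einf u)%E.
Proof.
move=> cu; rewrite limn_einf_lim; apply: lime_ge; first exact: is_cvg_einfs.
near=> n; apply: le_ereal_inf_tmp => _ [k /= nk <-]; apply: cu.
by apply: leq_trans nk; near: n; exact: nbhs_infty_ge.
Unshelve. all: by end_near. Qed.

(** The error budget: [x] for staying in [S_N], [g] for the decaying part of [F(M)], and [y + z] for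
    the terms vanishing as [n] grows, each below 1/6. *)
Lemma complement_bound (R : realType) (r x m f w g e z y : R) :
  r <= x + (4 / 3 + m + f - 1) -> x < 1 / 6 -> m <= y -> f <= w + g ->
  g <= e -> e < 1 / 6 -> w <= z -> y + z < 1 / 6 -> 1 / 6 <= 1 - r.
Proof. lra. Qed.

Section Conclusion.
Variables (R : realType) (K : fieldType) (T : local_tower R K) (chi : K -> R[i]).
Variables (alpha : R) (mu : R -> probability (Kborel T) R).
Variables (d : measure_display) (Om : measurableType d) (P : probability Om R).
Variables (X : R -> Om -> Kbar T).
Hypotheses (chiP : rank_zero_character T chi) (alpha0 : 0 < alpha).
Hypotheses (muP : stable_semigroup chi alpha mu) (XP : levy_process mu P X).
Local Notation q n := ((lq T n)%:R : R).
Local Notation v n := (rate T alpha n).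
Local Notation F n := (ball_law (q n) (v n) (depth T n)).

Let q2 n : 2 <= q n. Proof. by rewrite ler_nat lq_gt1. Qed.

Let v1 n : 1 <= v n.
Proof.
rewrite -[leLHS](powRr0 (q n)) ler_powR // ?ler1n ?(ltnW (lq_gt1 _ _)) //.
by rewrite divr_ge0 // ltW.
Qed.

Let vq n : 4 * alpha <= (ldeg T n)%:R -> v n ^+ 4 <= q n.
Proof.
move=> an; rewrite -powR_mulrn ?powR_ge0 // -powRrM -[leRHS]powRr1 ?ler0n //.
rewrite ler_powR ?ler1n ?(ltnW (lq_gt1 _ _)) // mulrAC ler_pdivrMr ?ltr0n ?ldeg_gt0 //.
by rewrite mul1r mulrC.
Qed.

Let law n t : 0 <= t -> P [set w | subS n.+1 (X t w)] = (F n t)%:E.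
Proof.
rewrite le_eqVlt => /orP[/eqP <-|t0].
  rewrite ball_law0 // (_ : [set w | _] = setT) ?probability_setT //.
  apply/seteqP; split=> // w _; rewrite /mkset (levy_0 XP).
  exact: (@subS0 _ _ T n.+1).
by rewrite (levy_law XP t0 (subS_measurable _)) (stable_subS chiP muP).
Qed.

Let law1_lt1 n : F n 1 < 1.
Proof.
have q0 : 0 < q n by apply: lt_le_trans (q2 n).
apply: le_lt_trans (ball_law_le _ (q2 n) (v1 n) ler01) _.
set w := _ ^- _; have w1 : w < 1.
  rewrite /w invf_lt1 ?exprn_gt0 // exprn_egt1 // ?ltr1n ?lq_gt1 //.
  by rewrite -lt0n; exact: leq_ltn_trans (depth_gt T n).
have e1 : expR (-1) < 1 :> R by rewrite -[ltRHS]expR0 ltr_expR ltrN10.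
(* This product is 1 minus the bound [w + (1 - w) * expR (-1)]. *)
have : 0 < (1 - w) * (1 - expR (-1)) by rewrite mulr_gt0 // subr_gt0.
rewrite -/w; lra.
Qed.

Lemma liminf_Qprob_gt0 N : (0 < limn_einf (fun n => Qprob P X n N.+1))%E.
Proof.
have F1_ge0 : 0 <= F N 1 by rewrite -lee_fin -law.
(* [M] depends on [N] alone and is fixed before [n], so that errors linear in [M] can then be made
   small. *)
have [M [pM eM]] : exists M : nat, F N 1 ^+ M < 1 / 6 /\ expR (- M%:R) < 1 / 6 :> R.
  have pc : (fun M => F N 1 ^+ M) @ \oo --> (0 : R).
    by apply: cvg_expr; rewrite ger0_norm.
  have ec : (fun M => expR (-1) ^+ M) @ \oo --> (0 : R).
    by apply: cvg_expr; rewrite ger0_norm ?expR_ge0 // -[ltRHS]expR0 ltr_expR ltrN10.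
  have s0 : 0 < 1 / 6 :> R by rewrite divr_gt0.
  have [a _ aP] := cvgr_lt _ pc _ s0; have [b _ bP] := cvgr_lt _ ec _ s0.
  exists (maxn a b); split; first by apply: aP; exact: leq_maxl.
  by have := bP _ (leq_maxr a b); rewrite /= -expRM_natl mulrN1.
have [n0 n0P] : exists n0, forall n, (n0 <= n)%N -> (M%:R + 1) * (5 / 8) ^+ n < 1 / 6 :> R.
  have c : (fun n => (M%:R + 1) * (5 / 8) ^+ n) @ \oo --> ((M%:R + 1) * 0 : R).
    apply: cvgMr; apply: cvg_expr; rewrite ger0_norm ?divr_ge0 //.
    by rewrite ltr_pdivrMr // mul1r ltr_nat.
  rewrite mulr0 in c; have s0 : 0 < 1 / 6 :> R by rewrite divr_gt0.
  have [n0 _ n0P] := cvgr_lt _ c _ s0.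
  by exists n0 => n; exact: n0P.
apply: (@lt_le_trans _ _ (1 / 6)%:E); first by rewrite lte_fin divr_gt0.
(* The final successor skips index 0, because [subS n.+1] constrains [layer T n]. The second entry
   of the maximum ensures [4 * alpha <= m], as [m > n]. *)
apply: (@limn_einf_ge _ _ _ (maxn n0 (Num.truncn (4 * alpha)).+1).+1) => -[//|n].
rewrite ltnS geq_max => /andP[n0n an].
have {}an : 4 * alpha <= (ldeg T n)%:R.
  apply: le_trans (ltW (truncnS_gt _)) _.
  by rewrite ler_nat (leq_trans an) // ltnW // ldeg_gt.
have vqn := vq an; set D := depth T n.
have dec k : (1 - F n (2 ^+ k)^-1) * (\sum_(j < M * 2 ^ k) F n (j%:R * (2 ^+ k)^-1)) <=
    4 / 3 + M%:R * (q n ^- D * v n ^+ D).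
  have h0 : 0 <= (2 ^+ k)^-1 :> R by rewrite invr_ge0 exprn_ge0.
  apply: le_trans (ball_law_renewal D (q2 n) (v1 n) vqn (M * 2 ^ k) h0) _.
  by rewrite natrM natrX mulfK // expf_neq0 // pnatr_eq0.
have := return_event_le XP (law N ler01) (law n) (ball_law0 _ _ (q2 n)) dec.
rewrite (Qprob_return XP) => Pret.
have [r rE] : exists r, P (return_event X n.+1 N.+1) = r%:E.
  have := fin_num_measure P _ (return_event_measurable XP n.+1 N.+1).
  by move=> /fineK <-; exists (fine (P (return_event X n.+1 N.+1))).
move: Pret; rewrite rE -EFinB !lee_fin => Pret.
have d1 := rate_decay D (q2 n) (v1 n) vqn.
have d2 := weight_decay D (q2 n) (v1 n) vqn.
have d3 := ball_law_le D (q2 n) (v1 n) (ler0n R M).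
have d4 : (5 / 8) ^+ D <= (5 / 8) ^+ n :> R.
  rewrite ler_wiXn2l ?divr_ge0 //; last exact: ltnW (depth_gt T n).
  by rewrite ler_pdivrMr // mul1r ler_nat.
have d5 : M%:R * (5 / 8) ^+ n + (5 / 8) ^+ n < 1 / 6 :> R.
  by have := n0P n n0n; rewrite mulrDl mul1r.
have d6 : M%:R * (q n ^- D * v n ^+ D) <= M%:R * (5 / 8) ^+ n.
  by rewrite ler_wpM2l // (le_trans d1).
have d7 : (1 - q n ^- D) * expR (- M%:R) <= expR (- M%:R).
  by rewrite ler_piMl ?expR_ge0 // gerBl invr_ge0 exprn_ge0 // ler0n.
exact: complement_bound Pret pM d6 d3 d7 eM (le_trans d2 d4) d5.
Qed.

End Conclusion.

Unset Implicit Arguments.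

Theorem theorem2 (R : realType) (K : fieldType) (T : local_tower R K)
    (chi : K -> R[i]) (alpha : R) (mu : R -> probability (Kborel T) R)
    (d : measure_display) (Om : measurableType d) (P : probability Om R)
    (X : R -> Om -> Kbar T) :
  rank_zero_character T chi ->
  0 < alpha ->
  stable_semigroup chi alpha mu ->
  levy_process mu P X ->
  (forall n, tamely_ramified (layer T n) (layer T n.+1) (tnorm T)) ->
  forall N : nat, (1 <= N)%N ->
    (0 < limn_einf (fun n : nat => Qprob P X n N))%E.
Proof.
move=> chiP alpha0 muP XP _ [//|N] _.
exact: liminf_Qprob_gt0 chiP alpha0 muP XP N.
Qed.
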